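(* Let $q\ge1$, $\nu>0$, $f\in L^2(Q_T)$, $u_0\in L^2(\Omega)$, $\Upsilon\in L^2(0,T;H^1(\Omega))$. There is a constant $C>0$ depending only on $q$ (in particular independent of $h,\tau,T,\nu$) such that any $u_{h\tau}\in\mathring{\mathcal V}_{h\tau}^{\mathsf{cont}(q)}$ with $u_{h\tau}(\cdot,0)=\Pi_hu_0$ and $$(\partial_tu_{h\tau},v_{h\tau})_{Q_T}+\nu(\nabla u_{h\tau},\nabla v_{h\tau})_{Q_T}=(f,v_{h\tau})_{Q_T}+\nu(\nabla\Upsilon,\nabla v_{h\tau})_{Q_T}\qquad\forall v_{h\tau}\in\mathring{\mathcal V}_{h\tau}^{\mathsf{disc}(q-1)}$$ satisfies $$\|u_{h\tau}\|_{C^0([0,T];L^2(\Omega))}^2+\nu\|\nabla\Pi_{q-1}^tu_{h\tau}\|_{L^2(Q_T)^d}^2\le C\Big(\|u_0\|_{L^2(\Omega)}^2+\|f\|_{L^1(0,T;L^2(\Omega))}^2+\nu\|\nabla\Upsilon\|_{L^2(Q_T)^d}^2\Big).$$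
   Context: Setting: $\Omega\subset\mathbb R^d$ ($d\in\{1,2,3\}$) is a polytopic domain, $T>0$, $Q_T=\Omega\times(0,T)$. $\mathcal T_h$ is a shape-regular conforming simplicial mesh of $\Omega$ with meshsize $h$. $0=t_0<t_1<\dots<t_N=T$ is an arbitrary partition (no quasi-uniformity), $I_n=(t_{n-1},t_n)$, $\tau_n=t_n-t_{n-1}$, $\tau=\max_n\tau_n$, $Q_n=\Omega\times I_n$. $(\cdot,\cdot)_D$ is the $L^2(D)$ inner product. $p\ge1$ is an integer. Spaces: $\mathring{\mathcal V}_h^p=\{v_h\in H_0^1(\Omega): v_h|_K\in\mathbb P^p(K)\ \forall K\in\mathcal T_h\}$; $\mathring{\mathcal V}_{h\tau}^{\mathsf{disc}(m)}$ is the space of functions whose restriction to each $Q_n$ lies in $\mathbb P^m(I_n)\otimes\mathring{\mathcal V}_h^p$ (no continuity across the $t_n$); $\mathring{\mathcal V}_{h\tau}^{\mathsf{cont}(m)}$ is the subspace of those that are continuous in time on $[0,T]$. Projections: $\Pi_h:L^2(\Omega)\to\mathring{\mathcal V}_h^p$ is the $L^2(\Omega)$-orthogonal projection. $\Pi_{q-1}^t$ is the $L^2$-orthogonal projection in time, on each $I_n$, onto polynomials in time of degree at most $q-1$. *)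

(* Defs.v *)
From HB Require Import structures.
From mathcomp Require Import all_boot all_order all_algebra.
From mathcomp Require Import all_classical all_reals all_analysis.
From mathcomp.multinomials Require Import (canonicals, coercions) mpoly.

Set Implicit Arguments.
Unset Strict Implicit.
Unset Printing Implicit Defensive.
Import Order.TTheory GRing.Theory Num.Theory.
Import numFieldNormedType.Exports.

Local Open Scope classical_set_scope.
Local Open Scope ring_scope.

Definition rV_display : measure_display.
Proof. exact: default_measure_display. Qed.

Section measurable_rV.
Context {R : realType}.
Variable n : nat.

(* Borel sigma-algebra of R^n, generated by the coordinate maps. *)
Let coors : 'I_n -> 'rV[R]_n -> measurableTypeR R := fun i x => x ord0 i.

Let rV_set0 : g_sigma_preimage coors set0.
Proof. exact: sigma_algebra0. Qed.

Let rV_setC A : g_sigma_preimage coors A -> g_sigma_preimage coors (~` A).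
Proof. exact: sigma_algebraC. Qed.

Let rV_bigcup (F : (set 'rV[R]_n)^nat) : (forall i, g_sigma_preimage coors (F i)) ->
  g_sigma_preimage coors (\bigcup_i (F i)).
Proof. exact: sigma_algebra_bigcup. Qed.

HB.instance Definition _ := @isMeasurable.Build rV_display
  'rV[R]_n (g_sigma_preimage coors) rV_set0 rV_setC rV_bigcup.

End measurable_rV.

Section coordinates.
Context {R : realType}.

Lemma measurable_fun_rVP d (T : measurableType d) n (f : T -> 'rV[R]_n) :
  (forall i, measurable_fun [set: T] (fun x => f x ord0 i)) ->
  measurable_fun [set: T] f.
Proof.
move=> mf.
pose coors (i : 'I_n) (x : 'rV[R]_n) : measurableTypeR R := x ord0 i.
suff : g_sigma_preimage (fun i => coors i \o f) `<=` measurable.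
  rewrite g_sigma_preimage_comp => H _ A mA.
  by apply: H; exists A.
apply: smallest_sub; first exact: sigma_algebra_measurable.
case: n => [|n] in f mf coors *; first by rewrite big_ord0.
rewrite -bigcup_mkord_ord; apply: bigcup_sub => i Ii.
by move=> A [B mB <-]; exact: mf.
Qed.

Lemma measurable_coord n (i : 'I_n) :
  measurable_fun [set: 'rV[R]_n] (fun x => x ord0 i).
Proof.
move=> _ Y mY; rewrite setTI; apply: sub_sigma_algebra => /=.
rewrite -bigcup_seq/=; exists i => /=; first by rewrite mem_index_enum.
by exists Y => //; rewrite setTI.
Qed.

Definition row_cons n (z : measurableTypeR R * 'rV[R]_n) : 'rV[R]_n.+1 :=
  row_mx (z.1 : R)%:M z.2.

Definition row_uncons n (v : 'rV[R]_n.+1) : measurableTypeR R * 'rV[R]_n :=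
  (v ord0 ord0, @rsubmx R 1 1 n v).

Lemma row_consK n : cancel (@row_cons n) (@row_uncons n).
Proof.
case=> x y; rewrite /row_uncons /row_cons; congr pair; last exact: row_mxKr.
transitivity ((row_mx (x : R)%:M y : 'rV[R]_(1 + n)) ord0 (lshift n ord0)).
  by congr (fun_of_matrix _ _ _); apply/val_inj.
by rewrite row_mxEl mxE eqxx mulr1n.
Qed.

Lemma measurable_row_cons n : measurable_fun setT (@row_cons n).
Proof.
apply: measurable_fun_rVP => i.
case: (@split_ordP 1 n i) => j ->.
  rewrite (_ : (fun _ => _) = fst); first exact: measurable_fst.
  apply/funext => z; apply: etrans (row_mxEl _ _ _ _) _.
  by rewrite mxE !ord1 mulr1n.
rewrite (_ : (fun _ => _) = (fun y : 'rV[R]_n => y ord0 j) \o snd).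
  exact: (measurableT_comp (measurable_coord j) measurable_snd).
by apply/funext => z; exact: row_mxEr.
Qed.

Lemma measurable_row_uncons n : measurable_fun setT (@row_uncons n).
Proof.
apply: measurable_fun_pair; first exact: measurable_coord.
apply: measurable_fun_rVP => i.
rewrite (_ : (fun _ => _) = fun v : 'rV[R]_n.+1 => v ord0 (rshift 1 i)).
  exact: measurable_coord.
by apply/funext => v; rewrite mxE.
Qed.

End coordinates.

(* Lebesgue measure on R^n, the n-fold product of the one on R. *)
Fixpoint leb (R : realType) (n : nat) : set 'rV[R]_n -> \bar R :=
  match n with
  | 0 => \d_(0 : 'rV[R]_0)
  | m.+1 => pushforward ((@lebesgue_measure R) \x @leb R m)%E (@row_cons R m)
  end.
Arguments leb {R} n.

Section leb_succ.
Context {R : realType} (n : nat) (m : {sigma_finite_measure set 'rV[R]_n -> \bar R}).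

Local Notation mu := (@lebesgue_measure R \x m)%E.
Let push := pushforward mu (@row_cons R n).
Let mf := @measurable_row_cons R n.

Let push0 : push set0 = 0%E. Proof. exact: measure0. Qed.

Let push_ge0 A : (0 <= push A)%E. Proof. exact: measure_ge0. Qed.

Let push_sigma_additive : semi_sigma_additive push.
Proof. exact: measure_semi_sigma_additive. Qed.

#[local] HB.instance Definition _ := isMeasure.Build _ _ _ push
  push0 push_ge0 push_sigma_additive.

Let push_sigma_finite : sigma_finite setT push.
Proof.
have /sigma_finiteP[F [TF ndF Foo]] := sigma_finiteT (@lebesgue_measure R).
have /sigma_finiteP[G [TG ndG Goo]] := sigma_finiteT m.
exists (fun k => @row_uncons R n @^-1` (F k `*` G k)).
  rewrite -preimage_bigcup (_ : \bigcup_k _ = setT) ?preimage_setT//.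
  rewrite -subTset => -[x y] _.
  have [i _ Fix] : (\bigcup_i F i) x by rewrite -TF.
  have [j _ Gjy] : (\bigcup_j G j) y by rewrite -TG.
  exists (maxn i j) => //; split=> /=.
    by move: x Fix; exact/subsetPset/ndF/leq_maxl.
  by move: y Gjy; exact/subsetPset/ndG/leq_maxr.
move=> k; have [mF Fk] := Foo k; have [mG Gk] := Goo k; split.
  rewrite -[X in measurable X]setTI; apply: measurable_row_uncons => //.
  exact: measurableX.
rewrite /push /pushforward -comp_preimage.
rewrite (_ : _ \o _ = id); last by apply/funext => z /=; rewrite row_consK.
by rewrite preimage_id product_measure1E// lte_mul_pinfty// ge0_fin_numE.
Qed.

#[local] HB.instance Definition _ := Measure_isSigmaFinite.Build _ _ _ push
  push_sigma_finite.

Definition leb_succ : {sigma_finite_measure set 'rV[R]_n.+1 -> \bar R} := push.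

End leb_succ.

Section leb_measure.
Context {R : realType} (n : nat).

Lemma leb_sigma_finite_measure :
  exists m : {sigma_finite_measure set 'rV[R]_n -> \bar R}, leb n = m.
Proof.
elim: n => [|k [m IH]]; first by exists (\d_(0 : 'rV[R]_0)).
by exists (leb_succ m); rewrite /= IH.
Qed.

Let leb0 : @leb R n set0 = 0%E.
Proof. by have [m ->] := leb_sigma_finite_measure; exact: measure0. Qed.

Let leb_ge0 A : (0 <= @leb R n A)%E.
Proof. by have [m ->] := leb_sigma_finite_measure; exact: measure_ge0. Qed.

Let leb_sigma_additive : semi_sigma_additive (@leb R n).
Proof.
by have [m ->] := leb_sigma_finite_measure; exact: measure_semi_sigma_additive.
Qed.

HB.instance Definition _ := isMeasure.Build _ _ _ (@leb R n)
  leb0 leb_ge0 leb_sigma_additive.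

Let leb_sigma_finite : sigma_finite setT (@leb R n).
Proof. by have [m ->] := leb_sigma_finite_measure; exact: sigma_finiteT. Qed.

HB.instance Definition _ := Measure_isSigmaFinite.Build _ _ _ (@leb R n)
  leb_sigma_finite.

End leb_measure.

Notation leb_xt d := (leb d \x lebesgue_measure)%E.

Section L2.
Context {disp : measure_display} {X : measurableType disp} {R : realType}.
Variables (mu : {measure set X -> \bar R}) (D : set X).

Definition L2 : set (X -> R) := [set f | f \_ D \in Lfun mu 2%:E].

Definition L2norm (f : X -> R) : \bar R := 'N[mu]_2%:E[EFin \o (f \_ D)]%E.

Definition L2ip (f g : X -> R) : R := \int[mu]_(x in D) (f x * g x).

Definition is_L2proj (V : set (X -> R)) (f w : X -> R) : Prop :=
  V w /\ forall v, V v -> L2ip w v = L2ip f v.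

End L2.

Section euclidean.
Context {R : realType} {d : nat}.
Implicit Types (x y : 'rV[R]_d) (A : set 'rV[R]_d).

Definition dot x y : R := \sum_i x ord0 i * y ord0 i.

(* The library norm on 'rV[R]_d is the sup norm. *)
Definition enorm x : R := Num.sqrt (dot x x).

Definition hull A : set 'rV[R]_d := smallest (@convex_set R 'rV[R]_d) A.

Definition diam A : R := sup [set enorm (z.1 - z.2) | z in A `*` A].

Definition inradius A : R :=
  sup [set r | 0 <= r /\ exists c, [set x | enorm (x - c) <= r] `<=` A].

Definition polytopic_domain (Omega : set 'rV[R]_d) : Prop :=
  [/\ Omega !=set0, connected Omega &
      exists Ps : seq (seq 'rV[R]_d),
        Omega = interior (\bigcup_(P in [set` Ps]) hull [set` P])].

(* A simplex of R^d is given by the d.+1 rows of a matrix, its vertices. *)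
Definition vertices (K : 'M[R]_(d.+1, d)) : set 'rV[R]_d :=
  [set row i K | i in setT].

Definition simplex (K : 'M[R]_(d.+1, d)) : set 'rV[R]_d := hull (vertices K).

Definition affinely_independent (K : 'M[R]_(d.+1, d)) : bool :=
  row_free (row_mx K (const_mx 1 : 'cV[R]_d.+1)).

(* Two elements meet in the (possibly empty) face spanned by their common
   vertices. *)
Definition conforming_mesh (Omega : set 'rV[R]_d) (Th : seq 'M[R]_(d.+1, d)) :=
  [/\ forall K, K \in Th -> affinely_independent K,
      closure Omega = \bigcup_(K in [set` Th]) simplex K &
      forall K K', K \in Th -> K' \in Th ->
        simplex K `&` simplex K' = hull (vertices K `&` vertices K')].

Definition shape_regular (gamma : R) (Th : seq 'M[R]_(d.+1, d)) : Prop :=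
  forall K, K \in Th -> diam (simplex K) <= gamma * inradius (simplex K).

End euclidean.

Section sobolev.
Context {R : realType} {d : nat}.
Variable Omega : set 'rV[R]_d.
Implicit Types (phi v : 'rV[R]_d -> R) (g : 'rV[R]_d -> 'rV[R]_d).

Definition partial (i : 'I_d) phi : 'rV[R]_d -> R := 'D_(delta_mx ord0 i) phi.

Definition grad phi : 'rV[R]_d -> 'rV[R]_d := fun x => \row_i partial i phi x.

Fixpoint Ck (k : nat) phi : Prop :=
  if k is k'.+1
  then (forall x, differentiable phi x) /\ (forall i, Ck k' (partial i phi))
  else continuous phi.

Definition test_function phi : Prop :=
  [/\ forall k, Ck k phi,
      compact (closure [set x | phi x != 0]) &
      closure [set x | phi x != 0] `<=` Omega].

(* v lies in H^1(Omega) exactly when such a g exists. *)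
Definition is_weak_grad v g : Prop :=
  [/\ L2 (leb d) Omega v,
      forall i, L2 (leb d) Omega (fun x => g x ord0 i) &
      forall phi, test_function phi -> forall i,
        L2ip (leb d) Omega v (partial i phi) =
        - L2ip (leb d) Omega (fun x => g x ord0 i) phi].

(* Closure of the test functions in H^1(Omega). *)
Definition H10 v : Prop :=
  exists2 g, is_weak_grad v g &
    forall e : R, 0 < e -> exists phi,
      [/\ test_function phi,
          (L2norm (leb d) Omega (v \- phi)%R < e%:E)%E &
          (L2norm (leb d) Omega (fun x => enorm (g x - grad phi x)) < e%:E)%E].

(* Functions on the mesh are represented by their continuous representatives,
   which coincide with a polynomial up to the boundary of each element. *)
Definition Vh (Th : seq 'M[R]_(d.+1, d)) (p : nat) : set ('rV[R]_d -> R) :=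
  [set v | H10 v /\
    forall K, K \in Th ->
      exists2 P : mpoly.mpoly d R, (mpoly.msize P <= p.+1)%N &
        forall x, simplex K x -> Omega x ->
          v x = mpoly.meval (fun i => x ord0 i) P].

End sobolev.

Section space_time.
Context {R : realType} {d : nat}.
Variables (Omega : set 'rV[R]_d) (T : R).
Implicit Types (u v w : 'rV[R]_d * R -> R) (G : 'rV[R]_d * R -> 'rV[R]_d).

Definition QT : set ('rV[R]_d * R) := Omega `*` `]0, T[.

Definition is_xgrad u G : Prop :=
  (forall i, L2 (leb_xt d) QT (fun z => G z ord0 i)) /\
  {ae lebesgue_measure, forall t : R, 0 < t < T ->
    is_weak_grad Omega (fun x => u (x, t)) (fun x => G (x, t))}.

(* L^2(0,T;H^1(Omega)): Bochner-measurable functions are identified with the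
   jointly measurable ones having a jointly measurable spatial gradient. *)
Definition L2H1 : set ('rV[R]_d * R -> R) :=
  [set u | L2 (leb_xt d) QT u /\ exists G, is_xgrad u G].

(* The spatial weak gradient, unique up to null sets; it is 0 if there is none. *)
Definition xgrad u : 'rV[R]_d * R -> 'rV[R]_d :=
  xget (fun=> 0) [set G | is_xgrad u G].

Definition dt u : 'rV[R]_d * R -> R :=
  fun z => derive1 (fun s : R => u (z.1, s)) z.2.

Definition xgrad_ip u v : R :=
  \int[leb_xt d]_(z in QT) dot (xgrad u z) (xgrad v z).

Definition xgrad_norm u : \bar R :=
  L2norm (leb_xt d) QT (fun z => enorm (xgrad u z)).

Definition norm_L1L2 u : \bar R :=
  (\int[lebesgue_measure]_(t in `]0%R, T[)
     L2norm (leb d) Omega (fun x => u (x, t)))%E.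

Definition norm_C0L2 u : \bar R :=
  ereal_sup [set L2norm (leb d) Omega (fun x => u (x, t)) | t in `[0, T]].

Section time_steps.
Variables (N : nat) (t : nat -> R).

Definition time_partition : Prop :=
  [/\ t 0 = 0, t N = T & forall n, (n < N)%N -> t n < t n.+1].

(* The slices t = t_n are negligible, but the values there must not spoil
   measurability. *)
Definition Vdisc (V : set ('rV[R]_d -> R)) (m : nat) : set ('rV[R]_d * R -> R) :=
  [set u | measurable_fun QT u /\
    forall n, (n < N)%N ->
      exists2 w : nat -> 'rV[R]_d -> R, (forall k, V (w k)) &
        forall x s, Omega x -> t n < s < t n.+1 ->
          u (x, s) = \sum_(k < m.+1) s ^+ k * w k x].

Definition Vcont (V : set ('rV[R]_d -> R)) (m : nat) : set ('rV[R]_d * R -> R) :=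
  [set u | Vdisc V m u /\
    forall x, Omega x -> {within `[0, T], continuous (fun s => u (x, s))}].

(* L^2(a,b)-orthogonal projection onto polynomials of degree at most m. *)
Definition poly_proj (a b : R) (m : nat) (g : R -> R) : {poly R} :=
  xget 0 [set P : {poly R} | (size P <= m.+1)%N /\
    forall Q : {poly R}, (size Q <= m.+1)%N ->
      L2ip lebesgue_measure `]a, b[ (horner P) (horner Q) =
      L2ip lebesgue_measure `]a, b[ g (horner Q)].

Definition time_proj (m : nat) u : 'rV[R]_d * R -> R := fun z =>
  \sum_(n < N | t n < z.2 < t n.+1)
    (poly_proj (t n) (t n.+1) m (fun s => u (z.1, s))).[z.2].

End time_steps.

End space_time.

(* Main.v *)
Require Import Defs.
From HB Require Import structures.
From mathcomp Require Import all_boot all_order all_algebra.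
From mathcomp Require Import all_classical all_reals all_analysis.
From mathcomp Require Import measurable_realfun ring lra.
From mathcomp.multinomials Require Import (canonicals, coercions) mpoly.

Set Implicit Arguments.
Unset Strict Implicit.
Unset Printing Implicit Defensive.
Import Order.TTheory GRing.Theory Num.Theory.
Import numFieldNormedType.Exports.

Local Open Scope classical_set_scope.
Local Open Scope ring_scope.

(* Let [P] be the L^2 projection in time onto degree [q-1], and let the scheme be tested on each
   slab with an operator in time applied to [u]. Testing with [P u] telescopes to the energy at
   the nodes and controls [grad (P u)]. To control [u] inside a slab, test instead on that slab
   with [P (w P u)], where the weight [w] decreases affinely from 1 to 0: since [s u' - q u] has
   degree less than [q] in time, the error [u - P u] contributes with a good sign, and the time
   term bounds the mean of [|u|^2] over the slab. An inverse estimate for polynomials in time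
   turns the largest such mean into a bound of [|u|] at all times, with a constant depending only
   on [q], and this closes the estimate against [f] in L^1(L^2). Spatial gradients being defined
   only up to null sets, gradients computed coefficientwise are identified with them through the
   fundamental lemma of the calculus of variations. *)

(** The weight sits between two projections for two reasons. A test function has only degree [q-1]
    in time, and the operator also acts on the gradient, where the diffusion must stay nonnegative:
    the sandwich is self-adjoint, and [w^2 <= w] gives [|P (w P g)|^2 <= (g, P (w P g))], so half of
    the diffusion absorbs the term in [Upsilon]. It is also a contraction in L^2 in time, so the
    inverse estimate bounds the test function at every time by the largest slab mean [J] of [|u|^2].
    The weighted inequality on slab [k] leaves the energy at [t k] with the wrong sign; testing with
    [P u] on the earlier slabs in the same test function cancels it. With [F] the L^1(L^2) norm of
    [f], [Y] the squared norm of the gradient of [Upsilon] and [E0] the initial energy, the result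
    is [J <= E0 + 2 sqrt(K J) F + nu Y], and Young's inequality absorbs [J]. The operators in time
    are linear maps on polynomials whose coefficients are functions of space: they preserve
    coefficients in [Vh] and commute with the spatial gradient. *)

Section poly_integral.
Context {R : realType}.
Implicit Types (a b : R) (p q : {poly R}).
Local Notation mu := (@lebesgue_measure R).

Definition pint a b p : R := \int[mu]_(s in `]a, b[) p.[s].

Lemma poly_integrable a b p : mu.-integrable `]a, b[ (EFin \o horner p).
Proof.
apply: (@integrableS _ _ _ mu `[a, b]) => //.
  by apply: subset_itv; rewrite bnd_simp.
apply: continuous_compact_integrable; first exact: segment_compact.
by apply: continuous_subspaceT => x; exact: continuous_horner.
Qed.

Lemma pintD a b p q : pint a b (p + q) = pint a b p + pint a b q.
Proof.
rewrite /pint -RintegralD//; try exact: poly_integrable.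
by apply: eq_Rintegral => s _; rewrite hornerD.
Qed.

Lemma pintZ a b c p : pint a b (c *: p) = c * pint a b p.
Proof.
rewrite /pint -RintegralZl//; last exact: poly_integrable.
by apply: eq_Rintegral => s _; rewrite hornerZ.
Qed.

Lemma pintN a b p : pint a b (- p) = - pint a b p.
Proof. by rewrite -scaleN1r pintZ mulN1r. Qed.

Lemma pintB a b p q : pint a b (p - q) = pint a b p - pint a b q.
Proof. by rewrite pintD pintN. Qed.

Lemma pint0 a b : pint a b 0 = 0.
Proof. by rewrite -(scale0r 0) pintZ mul0r. Qed.

Lemma pint_sum a b I (r : seq I) (P : pred I) (F : I -> {poly R}) :
  pint a b (\sum_(i <- r | P i) F i) = \sum_(i <- r | P i) pint a b (F i).
Proof. exact: (big_morph _ (@pintD a b) (@pint0 a b)). Qed.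

Lemma pint_ge0 a b p : (forall s, a < s < b -> 0 <= p.[s]) -> 0 <= pint a b p.
Proof. by move=> p0; apply: Rintegral_ge0 => s /=; rewrite in_itv/=; exact: p0. Qed.

Lemma pint_sqr_ge0 a b p : 0 <= pint a b (p * p).
Proof. by apply: pint_ge0 => s _; rewrite hornerM -expr2 sqr_ge0. Qed.

Lemma pint_deriv a b p : a < b -> pint a b p^`() = p.[b] - p.[a].
Proof.
move=> ab; rewrite /pint Rintegral_itv_bndo_bndc ?Rintegral_itv_obnd_cbnd//; last 2 first.
- apply: (@integrableS _ _ _ mu `[a, b]) => //.
    by apply: subset_itv; rewrite bnd_simp.
  apply: continuous_compact_integrable; first exact: segment_compact.
  by apply: continuous_subspaceT => x; exact: continuous_horner.
- exact: poly_integrable.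
rewrite /Rintegral (@continuous_FTC2 _ _ (horner p))//.
- by apply: continuous_subspaceT => x; exact: continuous_horner.
- split; first by move=> x _; exact: derivable_horner.
  + by apply: cvg_at_right_filter; exact: continuous_horner.
  + by apply: cvg_at_left_filter; exact: continuous_horner.
- by move=> x _; rewrite derive1E; apply: derive_val; exact: is_derive_poly.
Qed.

Lemma poly_antideriv p : exists P : {poly R}, P^`() = p.
Proof.
exists (\poly_(i < (size p).+1) (p`_i.-1 / i%:R)); apply/polyP => i.
rewrite coef_deriv coef_poly ltnS /=.
case: ltnP => ip; first by rewrite -[LHS]mulr_natr divfK// pnatr_eq0.
by rewrite mul0rn nth_default.
Qed.

(** An antiderivative of [p * p] is nondecreasing, and the zero integral makes it constant between
    [a] and [b]. A polynomial with too many roots is zero, so the antiderivative is constant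
    everywhere. *)
Lemma pint_eq0 a b p : a < b -> pint a b (p * p) = 0 -> p = 0.
Proof.
move=> ab p0.
have p2_ge0 (x : R) : 0 <= (p * p).[x] by rewrite hornerM -expr2 sqr_ge0.
have [P PE] := poly_antideriv (p * p).
have P0 x : a < x < b -> root (P - P.[a]%:P) x.
  move=> /andP[ax xb]; rewrite rootE !hornerE subr_eq0 eq_le; apply/andP; split.
    have : 0 <= pint x b P^`() by apply: pint_ge0 => s _; rewrite PE.
    rewrite pint_deriv// subr_ge0 => /le_trans; apply.
    by rewrite -subr_le0 -pint_deriv// PE p0.
  have : 0 <= pint a x P^`() by apply: pint_ge0 => s _; rewrite PE.
  by rewrite pint_deriv// subr_ge0.
have Pcst : P - P.[a]%:P = 0.
  apply/eqP; apply/negPn/negP => /max_poly_roots.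
  set m := size _.
  (* As many distinct roots as the size, one more than the degree allows; the shift [k.+2] keeps
     them strictly inside the interval. *)
  move=> /(_ [seq a + (b - a) / k.+2%:R | k <- iota 0 m]).
  rewrite size_map size_iota ltnn; move=> H; suff : false by [].
  apply: H.
    apply/allP => _ /mapP[k _ ->]; apply: P0.
    rewrite ltrDl divr_gt0 ?subr_gt0//= -ltrBrDl ltr_pdivrMr//.
    by rewrite ltr_pMr ?subr_gt0// ltr1n.
  rewrite map_inj_uniq ?iota_uniq// => i j /addrI.
  have ba0 : b - a != 0 by rewrite subr_eq0 gt_eqF.
  by move=> /(mulfI ba0)/invr_inj/eqP; rewrite eqr_nat => /eqP[].
have : (p * p) = 0.
  by rewrite -PE; move/eqP: Pcst; rewrite subr_eq0 => /eqP ->; rewrite derivC.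
by move/eqP; rewrite mulf_eq0 orbb => /eqP.
Qed.

Lemma pint_affine a b p : a < b ->
  pint a b p = (b - a) * pint 0 1 (p \Po ((b - a) *: 'X + a%:P)).
Proof.
move=> ab; have [P <-] := poly_antideriv p.
rewrite pint_deriv// -pintZ.
have := deriv_comp P ((b - a) *: 'X + a%:P).
rewrite derivD derivZ derivX derivC addr0 -[_%:A]/((b - a) *: 1) alg_polyC mulrC mul_polyC => <-.
by rewrite pint_deriv// !horner_comp !hornerE subrK.
Qed.

End poly_integral.

(** * The L^2 projection onto polynomials of bounded degree *)

Section gram.
Context {R : realType}.
Variables (a b : R) (ab : a < b) (m : nat).
Implicit Types p q : {poly R}.

Definition gram : 'M[R]_m := \matrix_(i, j) pint a b ('X^i * 'X^j).

(** A row in the kernel is the coefficient row of a polynomial of zero L^2 norm. *)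
Lemma gram_unit : gram \in unitmx.
Proof.
rewrite -row_free_unit -kermx_eq0; apply/eqP/row_matrixP => k.
rewrite row0; set v := row k _.
have vG : v *m gram = 0 by rewrite -row_mul mulmx_ker row0.
clearbody v.
have vv : pint a b (rVpoly v * rVpoly v) = 0.
  transitivity ((v *m gram *m v^T) ord0 ord0); last by rewrite vG mul0mx mxE.
  have vE : rVpoly v = \sum_(i < m) v ord0 i *: 'X^i.
    by rewrite /rVpoly poly_def; apply: eq_bigr => i _; rewrite valK.
  rewrite vE mulr_sumr pint_sum mxE; apply: eq_bigr => j _.
  rewrite mulr_suml pint_sum !mxE mulr_suml; apply: eq_bigr => i _.
  by rewrite -scalerAr -scalerAl !pintZ !mxE mulrC.
by have := pint_eq0 ab vv; move=> h; rewrite -[v]rVpolyK h linear0.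
Qed.

(** Solving the normal equations, instead of choosing a solution, makes the projection a linear map
    on polynomials, which can then act on the time coefficients of a function of space. *)
Definition pproj p : {poly R} :=
  rVpoly ((\row_(j < m) pint a b (p * 'X^j)) *m invmx gram).

Lemma size_pproj p : (size (pproj p) <= m)%N.
Proof. exact: size_poly. Qed.

Lemma pproj_is_linear : linear pproj.
Proof.
move=> c p q; rewrite /pproj -linearZ -linearD scalemxAl -mulmxDl.
congr (rVpoly (_ *m _)).
by apply/rowP => j; rewrite !mxE mulrDl pintD -scalerAl pintZ.
Qed.

HB.instance Definition _ := GRing.isLinear.Build R {poly R} {poly R} _ pproj
  pproj_is_linear.

Lemma pprojP p q : (size q <= m)%N -> pint a b (pproj p * q) = pint a b (p * q).
Proof.
move=> qm.
have qE : q = \sum_(j < m) q`_j *: 'X^j.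
  rewrite -poly_def; apply/polyP => i; rewrite coef_poly.
  by case: ltnP => // mi; rewrite nth_default// (leq_trans qm).
have H j : pint a b (pproj p * 'X^(val (j : 'I_m))) = pint a b (p * 'X^j).
  set v := \row_(j < m) pint a b (p * 'X^j).
  transitivity ((v *m invmx gram *m gram) ord0 j); last first.
    by rewrite mulmxKV ?gram_unit// mxE.
  rewrite /pproj -/v; set w := v *m _.
  have -> : rVpoly w = \sum_(i < m) w ord0 i *: 'X^i.
    by rewrite /rVpoly poly_def; apply: eq_bigr => i _; rewrite valK.
  rewrite mulr_suml pint_sum mxE; apply: eq_bigr => i _.
  by rewrite -scalerAl pintZ !mxE.
rewrite {1 2}qE !mulr_sumr !pint_sum; apply: eq_bigr => j _.
by rewrite -!scalerAr !pintZ H.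
Qed.

Lemma pproj_unique p (r : {poly R}) : (size r <= m)%N ->
  (forall q, (size q <= m)%N -> pint a b (r * q) = pint a b (p * q)) ->
  r = pproj p.
Proof.
move=> rm rP; apply/eqP; rewrite -subr_eq0; apply/eqP/(pint_eq0 ab).
have sm : (size (r - pproj p)%R <= m)%N.
  by rewrite (leq_trans (size_polyD _ _))// geq_max rm size_polyN size_pproj.
by rewrite {1}mulrBl pintB rP// pprojP// subrr.
Qed.

Lemma pint_sqr_pproj p : pint a b (pproj p * pproj p) <= pint a b (p * p).
Proof.
rewrite -subr_ge0.
suff -> : pint a b (p * p) - pint a b (pproj p * pproj p) =
    pint a b ((p - pproj p) * (p - pproj p)) by exact: pint_sqr_ge0.
have := pprojP p (size_pproj p).
rewrite (_ : (p - pproj p) * (p - pproj p) = p * p - pproj p * pproj p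
   - (p * pproj p - pproj p * pproj p) *+ 2); last by ring.
by rewrite pintB pintB mulr2n pintD !pintB => ->; ring.
Qed.

End gram.

(** * Inverse estimate for polynomials in time *)

Section inverse_estimate.
Context {R : realType}.

(** If [q] has zero norm, [H] says that an affine function of [c] is nonnegative, so its slope
    vanishes. Otherwise the norm of [x q]-scaled difference in the last case expands to a positive
    multiple of the claim. *)
Lemma pint_cauchy_schwarz (a b : R) (p q : {poly R}) :
  pint a b (p * q) ^+ 2 <= pint a b (p * p) * pint a b (q * q).
Proof.
have [q0|q0] := eqVneq (pint a b (q * q)) 0.
  have H c : 0 <= pint a b (p * p) + c * pint a b (p * q) *+ 2.
    have := pint_sqr_ge0 a b (p + c *: q).
    rewrite (_ : _ * _ = p * p + (c *: (p * q)) *+ 2 + c *: (c *: (q * q))).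
      by rewrite !mulr2n !pintD !pintZ q0 !mulr0 addr0.
    by rewrite -!mul_polyC; ring.
  rewrite q0 mulr0 le_eqVlt; apply/orP; left; rewrite sqrf_eq0; apply/eqP.
  apply: contrapT => /eqP pq0.
  (* This value of [c] would make the affine function equal to [- pint a b (p * p) - 2]. *)
  have := H (- (pint a b (p * p) + 1) / pint a b (p * q)).
  rewrite divfK//; have := pint_sqr_ge0 a b p; lra.
have qp : 0 < pint a b (q * q) by rewrite lt_neqAle eq_sym q0 pint_sqr_ge0.
have := pint_sqr_ge0 a b (pint a b (q * q) *: p - pint a b (p * q) *: q).
set x := pint a b (q * q); set y := pint a b (p * q).
rewrite (_ : _ * _ = (x ^+ 2) *: (p * p) - (x * y) *: (p * q) *+ 2 + (y ^+ 2) *: (q * q)); last first.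
  rewrite -!mul_polyC !polyCM; ring.
rewrite mulr2n pintD pintB pintD !pintZ -/x -/y => H.
have : 0 <= x * (pint a b (p * p) * x - y ^+ 2) by nra.
by rewrite pmulr_rge0// subr_ge0.
Qed.

(** The [r k] form the basis dual to the monomials for the L^2 product on the unit interval, so a
    coefficient is a product with [r k] and Cauchy-Schwarz applies. Summing all their norms gives
    one constant for every [k]; the [1] keeps it positive. *)
Lemma coef_bound (m : nat) : exists2 K : R, 0 < K &
  forall (p : {poly R}) k, (size p <= m)%N -> p`_k ^+ 2 <= K * pint 0 1 (p * p).
Proof.
pose r (k : 'I_m) : {poly R} := \sum_(j < m) invmx (gram 0 1 m) j k *: 'X^j.
exists (1 + \sum_k pint 0 1 (r k * r k)).
  by rewrite ltr_pwDl// sumr_ge0// => k _; exact: pint_sqr_ge0.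
move=> p k pm.
have [km|mk] := ltnP k m; last first.
  rewrite nth_default ?(leq_trans pm)// expr0n/= mulr_ge0 ?pint_sqr_ge0//.
  by rewrite addr_ge0// sumr_ge0// => ? _; exact: pint_sqr_ge0.
pose v : 'rV[R]_m := poly_rV p.
have pE : p = \sum_(i < m) v ord0 i *: 'X^i.
  have {1}<- : rVpoly v = p by rewrite poly_rV_K.
  by rewrite /rVpoly poly_def; apply: eq_bigr => i _; rewrite valK.
have -> : p`_k = pint 0 1 (p * r (Ordinal km)).
  transitivity ((v *m gram 0 1 m *m invmx (gram 0 1 m)) ord0 (Ordinal km)).
    by rewrite mulmxK ?gram_unit// mxE.
  rewrite mxE /r mulr_sumr pint_sum; apply: eq_bigr => j _.
  rewrite -scalerAr pintZ mulrC; congr (_ * _).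
  rewrite {1}pE mulr_suml pint_sum mxE; apply: eq_bigr => i _.
  by rewrite -scalerAl pintZ !mxE.
rewrite (le_trans (pint_cauchy_schwarz _ _ _ _))// mulrC ler_wpM2r ?pint_sqr_ge0//.
rewrite (bigD1 (Ordinal km))//= addrCA lerDl addr_ge0// sumr_ge0// => ? _.
exact: pint_sqr_ge0.
Qed.

(** Both sides scale alike under affine maps, so the unit interval suffices and the constant sees
    neither [a] nor [b]. There, a value is at most the sum of the moduli of the [m] coefficients. *)
Lemma inverse_estimate (m : nat) : exists2 K : R, 0 < K &
  forall (a b : R) (p : {poly R}) s, a < b -> (size p <= m)%N -> a <= s <= b ->
    (b - a) * p.[s] ^+ 2 <= K * pint a b (p * p).
Proof.
have [K K0 KP] := coef_bound m.
exists (K * (m%:R ^+ 2 + 1)); first by rewrite mulr_gt0// ltr_wpDl// sqr_ge0.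
move=> a b p s ab pm /andP[as_ sb].
have ba0 : 0 < b - a by rewrite subr_gt0.
pose l := (b - a) *: 'X + a%:P : {poly R}.
pose y := (s - a) / (b - a).
have sl : size l = 2.
  rewrite size_polyDl; first by rewrite size_scale ?gt_eqF// size_polyX.
  by rewrite size_scale ?gt_eqF// size_polyX (leq_ltn_trans (size_polyC_leq1 _)).
have y01 : 0 <= y <= 1.
  apply/andP; split; first by rewrite divr_ge0 ?subr_ge0// ltW.
  by rewrite ler_pdivrMr// mul1r lerD2r.
have -> : p.[s] = (p \Po l).[y].
  rewrite horner_comp; congr horner; rewrite /l hornerD hornerZ hornerX hornerC /y mulrC divfK ?gt_eqF// subrK//.
have pml : (size (p \Po l) <= m)%N.
  by rewrite size_comp_poly2.
rewrite pint_affine// -/l comp_polyM [leRHS]mulrCA ler_pM2l//.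
set r := p \Po l in pml *.
have rb : `|r.[y]| <= m%:R * Num.sqrt (K * pint 0 1 (r * r)).
  rewrite (horner_coef_wide _ pml) (le_trans (ler_norm_sum _ _ _))//.
  rewrite -[m in leRHS]card_ord mulr_natl -sumr_const ler_sum// => i _.
  rewrite normrM -[leRHS]mulr1 ler_pM//.
    by rewrite -sqrtr_sqr ler_wsqrtr// KP.
  by rewrite normrX exprn_ile1// ger0_norm//; case/andP: y01.
rewrite -real_normK ?num_real//.
have := lerXn2r 2 (normr_ge0 _) (le_trans (normr_ge0 _) rb) rb.
move=> /le_trans; apply.
have Kp : 0 <= K * pint 0 1 (r * r) by rewrite mulr_ge0 ?pint_sqr_ge0// ltW.
rewrite exprMn sqr_sqrtr//.
rewrite [leLHS]mulrCA [leLHS]mulrA ler_wpM2r ?pint_sqr_ge0//.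
by rewrite ler_pM2l// lerDl.
Qed.

End inverse_estimate.

(** * The weighted projection on one slab *)

Section weighted_projection.
Context {R : realType}.
Variables (a b : R) (ab : a < b) (m : nat).
Implicit Types p q : {poly R}.

Local Notation P := (pproj a b m).

Definition weight : {poly R} := (b - a)^-1 *: (b%:P - 'X).

Definition wproj p : {poly R} := P (weight * P p).

Lemma wproj_is_linear : linear wproj.
Proof. by move=> c p q; rewrite /wproj linearP mulrDr -scalerAr linearP. Qed.

HB.instance Definition _ := GRing.isLinear.Build R {poly R} {poly R} _ wproj
  wproj_is_linear.

Lemma weight_ge0_le1 s : a < s < b -> 0 <= weight.[s] <= 1.
Proof.
move=> /andP[as_ sb]; rewrite /weight !hornerE mulrC.
apply/andP; split; first by rewrite divr_ge0 ?subr_ge0// ltW.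
by rewrite ler_pdivrMr ?subr_gt0// mul1r lerD2l lerN2 ltW.
Qed.

Lemma pint_mul_pproj p : pint a b (p * P p) = pint a b (P p * P p).
Proof. by rewrite pprojP ?size_pproj. Qed.

(** The derivative already has degree below [m], so the projection may be dropped against it; what
    remains is half the derivative of [p * p]. *)
Lemma pint_deriv_pproj p : (size p <= m.+1)%N ->
  pint a b (p^`() * P p) = (p.[b] ^+ 2 - p.[a] ^+ 2) / 2.
Proof.
move=> pm.
have p'm : (size p^`() <= m)%N.
  have [->|p0] := eqVneq p 0; first by rewrite deriv0 size_poly0.
  by rewrite -ltnS (leq_trans (lt_size_deriv p0)).
rewrite mulrC pprojP//.
have := pint_deriv (p * p) ab; rewrite derivM pintD (mulrC p^`()) !hornerM -!expr2 => <-.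
by field.
Qed.

(* [s p' - m p] has degree less than [m], so it does not see [p - P p]; this makes
   the contribution of the projection error nonnegative. *)
Lemma pint_deriv_wproj_ge p : (size p <= m.+1)%N ->
  pint a b (p * p) / (b - a) / 2 - p.[a] ^+ 2 / 2 <= pint a b (p^`() * wproj p).
Proof.
move=> pm.
have p'm : (size p^`() <= m)%N.
  have [->|p0] := eqVneq p 0; first by rewrite deriv0 size_poly0.
  by rewrite -ltnS (leq_trans (lt_size_deriv p0)).
have ba0 : b - a != 0 by rewrite subr_eq0 gt_eqF.
pose r := p - P p.
have rP q : (size q <= m)%N -> pint a b (r * q) = 0.
  by move=> qm; rewrite mulrBl pintB pprojP// subrr.
have rr : pint a b (r * p) = pint a b (r * r).
  by rewrite {3}/r mulrBr pintB (rP (P p)) ?size_pproj// subr0.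
have sp : (size ('X * p^`() - m%:R *: p)%R <= m)%N.
  apply/leq_sizeP => j mj; rewrite coefB coefXM coefZ coef_deriv.
  move: mj; rewrite leq_eqVlt => /predU1P[<-|mj].
    case: m pm => [|k] _; first by rewrite eqxx mul0r subrr.
    by rewrite /= -[X in X - _]mulr_natl subrr.
  rewrite (@nth_default _ _ p j) ?(leq_trans pm)// mulr0 subr0.
  by case: j mj => //= j mj; rewrite nth_default ?mul0rn// (leq_trans pm).
(* Orthogonality of [r] to [s p' - m p] trades [s p'] for [m p], and the product of [r] with [p] is
   the squared norm of [r]. *)
have Xp : pint a b (r * ('X * p^`())) = m%:R * pint a b (r * r).
  have := rP _ sp; rewrite mulrBr pintB -scalerAr pintZ rr => /eqP.
  by rewrite subr_eq0 => /eqP.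
have -> : pint a b (p^`() * wproj p) = pint a b (p^`() * (weight * P p)).
  by rewrite mulrC pprojP// mulrC.
(* The first part is integrated by parts through the derivative of [w p^2], where the weight kills
   the value at [b]. In the part with [r], the constant [b] of the weight is orthogonal to [r], and
   [Xp] evaluates the rest. *)
have -> : p^`() * (weight * P p) = weight * (p * p^`()) - p^`() * weight * r.
  rewrite /r; ring.
rewrite pintB.
have -> : pint a b (p^`() * weight * r) = - (m%:R * pint a b (r * r) / (b - a)).
  rewrite /weight (_ : _ * _ * r = (b - a)^-1 *: (b *: (r * p^`()) - r * ('X * p^`()))).
    by rewrite pintZ pintB pintZ Xp rP// mulr0 sub0r mulrN mulrC.
  by rewrite -!mul_polyC; ring.
have : pint a b (weight * (p * p))^`() = - p.[a] ^+ 2.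
  have wE s : weight.[s] = (b - a)^-1 * (b - s) by rewrite /weight !hornerE.
  by rewrite pint_deriv// !hornerM !wE subrr mulr0 mul0r sub0r mulVf// mul1r -expr2.
rewrite derivM derivM (_ : weight^`() = - ((b - a)^-1)%:P); last first.
  by rewrite /weight derivZ derivB derivC derivX sub0r scalerN alg_polyC.
rewrite pintD mulNr pintN mul_polyC pintZ (mulrC p^`()) -mulr2n mulrnAr mulr2n pintD => W.
have : 0 <= m%:R * pint a b (r * r) / (b - a).
  by rewrite mulr_ge0 ?invr_ge0 ?subr_ge0 ?(ltW ab)// mulr_ge0// pint_sqr_ge0.
move: W; rewrite [_ / (b - a) / 2]mulrAC -[_ * _ / (b - a)]mulrA.
rewrite (mulrC (pint a b (p * p) / 2)).
set A := (b - a)^-1; set X := pint a b (p * p); set Y := pint a b (weight * _).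
set Z := _ * (_ * A); lra.
Qed.

(** The outer projection decreases the norm, and [w^2 <= w] on the interval. This is the coercivity
    that the diffusion term requires. *)
Lemma pint_sqr_wproj_le p : pint a b (wproj p * wproj p) <= pint a b (p * wproj p).
Proof.
have -> : pint a b (p * wproj p) = pint a b (weight * P p * P p).
  by rewrite -(pprojP ab p (size_pproj _ _ _ _)) mulrC pprojP ?size_pproj.
apply: (le_trans (pint_sqr_pproj ab _ _)).
rewrite -subr_ge0 -pintB; apply: pint_ge0 => s /weight_ge0_le1 /andP[w0 w1].
rewrite !(hornerD, hornerN, hornerM).
set w := weight.[s] in w0 w1 *; set y := (P p).[s].
rewrite (_ : _ - _ = w * (1 - w) * y ^+ 2); last by ring.
by rewrite mulr_ge0 ?sqr_ge0// mulr_ge0// subr_ge0.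
Qed.

Lemma pint_sqr_wproj_le_sqr p : pint a b (wproj p * wproj p) <= pint a b (p * p).
Proof.
apply: (le_trans (pint_sqr_pproj ab _ _)).
apply: le_trans (pint_sqr_pproj ab m p).
rewrite -subr_ge0 -pintB; apply: pint_ge0 => s /weight_ge0_le1 /andP[w0 w1].
rewrite !(hornerD, hornerN, hornerM).
set w := weight.[s] in w0 w1 *; set y := (P p).[s].
rewrite (_ : _ - _ = (1 - w) * (1 + w) * y ^+ 2); last by ring.
by rewrite mulr_ge0 ?sqr_ge0// mulr_ge0 ?subr_ge0// addr_ge0.
Qed.

End weighted_projection.

(** * Changing an integrand on a null set *)

Section null_sets.
Context d (T : measurableType d) (R : realType) (mu : {measure set T -> \bar R}).
Import HBNNSimple.

(** The integral of [f] is a supremum over simple functions below [f]. Cutting such a function to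
    the complement of [N] keeps its integral and puts it below [g]. *)
Let ge0_integral_null_le (f g : T -> \bar R) (N : set T) :
  measurable N -> mu N = 0%E -> (forall x, 0 <= f x)%E -> (forall x, 0 <= g x)%E ->
  (forall x, ~ N x -> f x = g x) -> (\int[mu]_x f x <= \int[mu]_x g x)%E.
Proof.
move=> mN N0 f0 g0 fg; rewrite (ge0_integralTE mu f0); apply: ge_ereal_sup => _ [h /= hf <-].
have mNC := measurableC mN.
rewrite -integralT_nnsfun.
rewrite (ge0_negligible_integral mN)//; last first.
- by move=> x _; rewrite lee_fin.
- by apply/measurable_EFinP.
rewrite setTD integral_mkcond.
rewrite (ge0_integralTE mu g0); apply: ereal_sup_ubound; exists (proj_nnsfun h mNC) => /=.
- move=> x /=; rewrite /mindic indicE in_setC.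
  have [xN|xN] := boolP (x \in N); rewrite ?mulr0 ?mulr1//=.
  by rewrite -fg ?hf// => /mem_set; rewrite (negbTE xN).
- rewrite -integralT_nnsfun; apply: eq_integral => x _ /=.
  rewrite /mindic indicE in_setC patchE in_setC.
  by case: ifP; rewrite ?mulr1 ?mulr0.
Qed.

(* No measurability is required of the integrands. *)
Lemma integral_null_set (f g : T -> \bar R) (N : set T) :
  measurable N -> mu N = 0%E -> (forall x, ~ N x -> f x = g x) ->
  (\int[mu]_x f x = \int[mu]_x g x)%E.
Proof.
move=> mN N0 fg; rewrite [LHS]integralE [RHS]integralE.
have fgp x : ~ N x -> (f^\+ x = g^\+ x)%E by move=> Nx; rewrite !funeposE fg.
have fgn x : ~ N x -> (f^\- x = g^\- x)%E by move=> Nx; rewrite !funenegE fg.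
congr (_ - _)%E; apply/eqP; rewrite eq_le; apply/andP; split.
- exact: ge0_integral_null_le fgp.
- by apply: (ge0_integral_null_le mN N0) => // x Nx; rewrite fgp.
- exact: ge0_integral_null_le fgn.
- by apply: (ge0_integral_null_le mN N0) => // x Nx; rewrite fgn.
Qed.

Lemma Rintegral_null_set (D : set T) (f g : T -> R) (N : set T) :
  measurable N -> mu N = 0%E -> (forall x, D x -> ~ N x -> f x = g x) ->
  \int[mu]_(x in D) f x = \int[mu]_(x in D) g x.
Proof.
move=> mN N0 fg; rewrite Rintegral_mkcond [RHS]Rintegral_mkcond; congr fine.
apply: (integral_null_set mN N0) => x Nx; rewrite !patchE.
by case: ifPn => // /set_mem Dx; rewrite fg.
Qed.

End null_sets.

(** * Square-integrable functions *)

Section L2_lemmas.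
Context d (T : measurableType d) (R : realType) (mu : {measure set T -> \bar R}).
Implicit Types f g : T -> R.

Lemma Lfun2P f : f \in Lfun mu 2%:E <->
  measurable_fun setT f /\ mu.-integrable setT (EFin \o (fun x => f x ^+ 2)).
Proof.
split=> [f2|[mf /integrableP[_ f2]]].
  split; last exact: Lfun2_integrable_sqr.
  by case/andP: f2; rewrite inE.
apply/andP; split; rewrite inE//= /finite_norm unlock poweR_lty//.
apply: le_lt_trans f2; apply: ge0_le_integral => //.
- by move=> x _; exact: poweR_ge0.
- apply/measurable_EFinP; apply: (measurableT_comp (measurable_powR _)).
  exact: measurableT_comp.
- apply/measurable_EFinP; apply: measurableT_comp => //; exact: measurable_funX.
- by move=> x _; rewrite /= lee_fin normrX powR_mulrn.
Qed.

Lemma Lfun2_measurable f : f \in Lfun mu 2%:E -> measurable_fun setT f.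
Proof. by case/Lfun2P. Qed.

Let le12 : (1 <= 2%:E :> \bar R)%E. Proof. by rewrite lee_fin ler1n. Qed.

Lemma Lfun2_0 : (fun=> 0) \in Lfun mu (2%:E : \bar R).
Proof. by have [] := Lfun_submod_closed mu le12. Qed.

Lemma Lfun2_axpy c f g : f \in Lfun mu 2%:E -> g \in Lfun mu 2%:E ->
  (fun x => c * f x + g x) \in Lfun mu 2%:E.
Proof. by have [_ +] := Lfun_submod_closed mu le12; exact. Qed.

Lemma Lfun2Z c f : f \in Lfun mu 2%:E -> (fun x => c * f x) \in Lfun mu 2%:E.
Proof.
move=> f2; have := Lfun2_axpy c f2 Lfun2_0.
by under eq_fun do rewrite addr0.
Qed.

Lemma Lfun2D f g : f \in Lfun mu 2%:E -> g \in Lfun mu 2%:E ->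
  (fun x => f x + g x) \in Lfun mu 2%:E.
Proof.
move=> f2 g2; have := Lfun2_axpy 1 f2 g2.
by under eq_fun do rewrite mul1r.
Qed.

Lemma Lfun2_sum I (r : seq I) (P : pred I) (F : I -> T -> R) :
  (forall i, P i -> F i \in Lfun mu 2%:E) ->
  (fun x => \sum_(i <- r | P i) F i x) \in Lfun mu 2%:E.
Proof.
move=> F2; elim: r => [|i r IH].
  by under eq_fun do rewrite big_nil; exact: Lfun2_0.
under eq_fun do rewrite big_cons.
by case Pi: (P i) => //; apply: Lfun2D => //; exact: F2.
Qed.

Lemma Lfun2_mul_integrable f g : f \in Lfun mu 2%:E -> g \in Lfun mu 2%:E ->
  mu.-integrable setT (fun x => (f x * g x)%:E).
Proof. by move=> f2 g2; apply/Lfun1_integrable; exact: Lfun2_mul_Lfun1. Qed.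

Lemma Lnorm2_sqr f : ('N[mu]_2%:E[EFin \o f] ^+ 2 = \int[mu]_x (f x ^+ 2)%:E)%E.
Proof.
have -> : ('N[mu]_2%:E[EFin \o f] ^+ 2 = 'N[mu]_2%:E[EFin \o f] `^ 2)%E.
  have := Lnorm_ge0 mu 2%:E (EFin \o f).
  move: ('N[mu]_2%:E[EFin \o f])%E => [r| |]//=.
    by rewrite lee_fin => r0; rewrite powR_mulrn.
  by rewrite pnatr_eq0/= mulyy.
rewrite powR_Lnorm//; apply: eq_integral => x _ /=.
by rewrite powR_mulrn// real_normK ?num_real.
Qed.

Lemma Lfun2_Lnorm f : f \in Lfun mu 2%:E ->
  'N[mu]_2%:E[EFin \o f]%E = (Num.sqrt (\int[mu]_x (f x ^+ 2)))%:E.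
Proof.
move=> f2.
have ff : ('N[mu]_2%:E[EFin \o f] \is a fin_num)%E.
  by rewrite ge0_fin_numE ?Lnorm_ge0//; case/andP: f2 => _; rewrite inE.
rewrite -(fineK ff); congr EFin.
have := Lnorm2_sqr f; rewrite -(fineK ff) -EFin_expe /Rintegral => <- /=.
by rewrite sqrtr_sqr ger0_norm// fine_ge0// Lnorm_ge0.
Qed.

Lemma Rintegral_sum I (r : seq I) (P : pred I) (F : I -> T -> R) :
  (forall i, P i -> mu.-integrable setT (EFin \o F i)) ->
  mu.-integrable setT (EFin \o (fun x => \sum_(i <- r | P i) F i x)) /\
  \int[mu]_x (\sum_(i <- r | P i) F i x) = \sum_(i <- r | P i) \int[mu]_x F i x.
Proof.
move=> Fi; elim: r => [|i r [IH1 IH2]].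
  split; last by rewrite big_nil; under eq_Rintegral do rewrite big_nil;
    rewrite Rintegral_cst// mul0r.
  rewrite (_ : _ \o _ = cst 0%E); first exact: integrable0.
  by apply/funext => x /=; rewrite big_nil.
case: (boolP (P i)) => Pi; last first.
  rewrite big_cons (negbTE Pi); under eq_Rintegral do rewrite big_cons (negbTE Pi).
  split => //; rewrite (_ : _ \o _ = EFin \o (fun x => \sum_(i <- r | P i) F i x))//.
  by apply/funext => x /=; rewrite big_cons (negbTE Pi).
have -> : (fun x => \sum_(j <- i :: r | P j) F j x) =
          (fun x => F i x + \sum_(j <- r | P j) F j x).
  by apply/funext => x; rewrite big_cons Pi.
split; last by rewrite RintegralD//= ?IH2 ?big_cons ?Pi//; exact: Fi.
by apply: (integrableD measurableT (Fi _ Pi) IH1).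
Qed.

(** Young's inequality replaces Cauchy-Schwarz: every later use absorbs one of the two halves. *)
Lemma Rintegral_mul_le (f g : T -> R) : f \in Lfun mu 2%:E -> g \in Lfun mu 2%:E ->
  \int[mu]_x (f x * g x) <= (\int[mu]_x (f x ^+ 2) + \int[mu]_x (g x ^+ 2)) / 2.
Proof.
move=> f2 g2.
have if2 := Lfun2_integrable_sqr f2; have ig2 := Lfun2_integrable_sqr g2.
have i2 : mu.-integrable setT (EFin \o (fun x => f x ^+ 2 + g x ^+ 2)).
  exact: (integrableD measurableT if2 ig2).
rewrite -RintegralD// -RintegralZr//.
apply: le_Rintegral => //; first exact: Lfun2_mul_integrable.
  exact: (integrableZr measurableT _ i2).
move=> x _; have := sqr_ge0 (f x - g x); rewrite sqrrB; lra.
Qed.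

End L2_lemmas.

(** * Functions that are polynomial in time on the slabs of a partition *)

Section slabs.
Context d (X : measurableType d) (R : realType).
Variable m1 : {sigma_finite_measure set X -> \bar R}.
Local Notation mu := (@lebesgue_measure R).
Local Notation XR := (X * measurableTypeR R)%type.

(** By Tonelli the squared norm factors into those of [w] and [h]. *)
Lemma Lfun2_tensor (w : X -> R) (h : R -> R) :
  w \in Lfun m1 2%:E -> h \in Lfun mu 2%:E ->
  (fun z : XR => w z.1 * h z.2) \in Lfun (m1 \x mu)%E 2%:E.
Proof.
move=> /[dup] /Lfun2_measurable mw /Lfun2_integrable_sqr/integrableP[_ w2].
move=> /[dup] /Lfun2_measurable mh /Lfun2_integrable_sqr/integrableP[_ h2].
have mwh : measurable_fun setT (fun z : XR => w z.1 * h z.2).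
  apply: measurable_funM.
    exact: (measurableT_comp mw measurable_fst).
  exact: (measurableT_comp mh measurable_snd).
apply/Lfun2P; split=> //.
apply/(integrable12ltyP m1 mu); first by apply/measurable_EFinP; exact: measurable_funX.
set A := (\int[mu]_x `|(EFin \o (fun x => (h x ^+ 2)%R)) x|)%E in h2.
rewrite (_ : (\int[_]_x _)%E = (\int[m1]_x (`|(EFin \o (fun x => (w x ^+ 2)%R)) x| * A))%E); last first.
  apply: eq_integral => x _ /=; rewrite /A -ge0_integralZl//=.
  - by apply: eq_integral => s _; rewrite -EFinM exprMn normrM.
  - by apply/measurable_EFinP; apply: measurableT_comp => //; exact: measurable_funX.
rewrite ge0_integralZr//=.
- by apply: lte_mul_pinfty => //; [exact: integral_ge0|rewrite ge0_fin_numE//; exact: integral_ge0].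
- by apply/measurable_EFinP; apply: measurableT_comp => //; exact: measurable_funX.
- exact: integral_ge0.
Qed.

Definition L2poly (m : nat) (U : X -> {poly R}) : Prop :=
  (forall x, (size (U x) <= m)%N) /\ forall k, (fun x => (U x)`_k) \in Lfun m1 2%:E.

(** The extension by zero in time turns integrals over a slab into integrals over the whole product,
    where Fubini applies directly. *)
Definition slab (a b : R) (U : X -> {poly R}) (z : XR) : R :=
  ((horner (U z.1)) \_ `]a, b[) z.2.

(** Each coefficient of the image is a finite combination of those of [U], weighted by the
    coefficients of [M 'X^j], which are constant in space. *)
Lemma L2poly_linear (m m' : nat) (M : {linear {poly R} -> {poly R}}) U :
  L2poly m U -> (forall p : {poly R}, (size p <= m)%N -> (size (M p) <= m')%N) ->
  L2poly m' (M \o U).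
Proof.
move=> [sU U2] sM; split=> [x|k /=]; first exact: sM.
rewrite (_ : (fun _ => _) = (fun x => \sum_(j < m) (M 'X^j)`_k * (U x)`_j)).
  by apply: Lfun2_sum => j _; exact: Lfun2Z.
apply/funext => x.
have {1}-> : U x = \sum_(j < m) (U x)`_j *: 'X^j.
  rewrite -poly_def; apply/polyP => i; rewrite coef_poly.
  by case: ltnP => // mi; rewrite nth_default// (leq_trans (sU x)).
by rewrite linear_sum coef_sum; apply: eq_bigr => j _; rewrite linearZ coefZ mulrC.
Qed.

Lemma L2poly_horner m U s : L2poly m U -> (fun x => (U x).[s]) \in Lfun m1 2%:E.
Proof.
move=> [sU U2]; under eq_fun do rewrite (horner_coef_wide _ (sU _)).
by apply: Lfun2_sum => k _; under eq_fun do rewrite mulrC; exact: Lfun2Z.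
Qed.

Lemma cut_poly_Lfun2 a b (p : {poly R}) :
  (horner p \_ `]a, b[) \in Lfun mu 2%:E.
Proof.
apply/Lfun2P; split.
  apply/(measurable_restrictT _ _).1 => //.
  by have /measurable_EFinP := measurable_int _ (poly_integrable a b p).
have -> : EFin \o (fun x => (horner p \_ `]a, b[) x ^+ 2) =
    (EFin \o horner (p * p)) \_ `]a, b[.
  apply/funext => s /=; rewrite !patchE; case: ifPn => // _ /=.
    by rewrite hornerM expr2.
  by rewrite expr0n.
apply/(integrable_mkcond _ _).1 => //; exact: poly_integrable.
Qed.

Lemma slab_Lfun2 m a b U : L2poly m U -> slab a b U \in Lfun (m1 \x mu)%E 2%:E.
Proof.
move=> [sU U2].
have -> : slab a b U = fun z => \sum_(k < m) (U z.1)`_k * (horner 'X^k \_ `]a, b[) z.2.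
  apply/funext => -[x s]; rewrite /slab/= !patchE.
  case: ifPn => sI; first by rewrite (horner_coef_wide _ (sU x)); apply: eq_bigr => k _;
    rewrite patchE sI hornerXn.
  by rewrite big1// => k _; rewrite patchE (negbTE sI) mulr0.
by apply: Lfun2_sum => k _; exact: (Lfun2_tensor (U2 k) (cut_poly_Lfun2 a b 'X^k)).
Qed.

Lemma slab_mul a b U V z :
  slab a b U z * slab a b V z = slab a b (fun x => U x * V x) z.
Proof.
by rewrite /slab !patchE; case: ifPn => _; rewrite ?hornerM// mul0r.
Qed.

(** Fubini, integrating in time first. The integrability in space is recorded because inequalities
    between such integrals are later obtained pointwise in [x]. *)
Lemma Rintegral_slab_mul m m' a b U V : L2poly m U -> L2poly m' V ->
  m1.-integrable setT (fun x => (pint a b (U x * V x))%:E) /\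
  \int[(m1 \x mu)%E]_z (slab a b U z * slab a b V z) =
  \int[m1]_x pint a b (U x * V x).
Proof.
move=> U2 V2.
have iUV := Lfun2_mul_integrable (slab_Lfun2 a b U2) (slab_Lfun2 a b V2).
have FE : fubini_F mu (fun z => (slab a b U z * slab a b V z)%:E) =
    fun x => (pint a b (U x * V x))%:E.
  apply/funext => x; rewrite /fubini_F.
  under eq_integral do rewrite slab_mul.
  rewrite /slab /= /pint /Rintegral fineK; last first.
    by apply: integrable_fin_num => //; exact: poly_integrable.
  by rewrite [RHS]integral_mkcond; apply: eq_integral => s _; rewrite !patchE; case: ifP.
split; first by have := integrable_fubini_F iUV; rewrite FE.
by rewrite /Rintegral; congr fine; rewrite -integral12_prod_meas1// FE.
Qed.

Section partition.
Variables (N : nat) (t : nat -> R) (nt : forall n, (n < N)%N -> t n < t n.+1).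

Lemma partition_le i j : (i <= j <= N)%N -> t i <= t j.
Proof.
move=> /andP[]; elim: j => [|j IH].
  by rewrite leqn0 => /eqP ->.
rewrite leq_eqVlt => /predU1P[-> //|]; rewrite ltnS => ij jN.
by rewrite (le_trans (IH ij (ltnW jN)))// ltW// nt.
Qed.

Lemma partition_uniq i j s : (i < N)%N -> (j < N)%N ->
  t i < s < t i.+1 -> t j < s < t j.+1 -> i = j.
Proof.
move=> iN jN /andP[i1 i2] /andP[j1 j2]; case: (ltngtP i j) => // ij.
- have := @partition_le i.+1 j; rewrite ij ltnW// => /(_ isT).
  by rewrite leNgt (lt_trans j1 i2).
- have := @partition_le j.+1 i; rewrite ij ltnW// => /(_ isT).
  by rewrite leNgt (lt_trans i1 j2).
Qed.

Definition slabs (U : nat -> X -> {poly R}) (z : XR) : R :=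
  \sum_(n < N) slab (t n) (t n.+1) (U n) z.

Lemma slabsE U n x s : (n < N)%N -> t n < s < t n.+1 -> slabs U (x, s) = (U n x).[s].
Proof.
move=> nN sn; rewrite /slabs (bigD1 (Ordinal nN))//= big1 ?addr0.
  by rewrite /slab/= patchE mem_set//= in_itv.
move=> j jn; rewrite /slab patchE memNset//= in_itv /= => sj.
by move/eqP: jn; apply; apply/val_inj; exact: partition_uniq sj sn.
Qed.

Lemma slabs_Lfun2 m U : (forall n, (n < N)%N -> L2poly m (U n)) ->
  slabs U \in Lfun (m1 \x mu)%E 2%:E.
Proof. by move=> U2; apply: Lfun2_sum => n _; apply: slab_Lfun2; exact: U2. Qed.

Lemma slabs_mul U V z :
  slabs U z * slabs V z = \sum_(n < N) slab (t n) (t n.+1) (U n) z * slab (t n) (t n.+1) (V n) z.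
Proof.
rewrite /slabs mulr_suml; apply: eq_bigr => i _; rewrite mulr_sumr (bigD1 i)//= big1 ?addr0//.
move=> j ji; rewrite /slab !patchE.
case: ifPn => [/set_mem si|]; last by rewrite mul0r.
case: ifPn => [/set_mem sj|]; last by rewrite mulr0.
move: si sj; rewrite /= !in_itv /= => si sj.
by move/eqP: ji; case; apply/val_inj; exact: partition_uniq sj si.
Qed.

Lemma Rintegral_slabs_mul m m' U V :
  (forall n, (n < N)%N -> L2poly m (U n)) -> (forall n, (n < N)%N -> L2poly m' (V n)) ->
  \int[(m1 \x mu)%E]_z (slabs U z * slabs V z) =
  \sum_(n < N) \int[m1]_x pint (t n) (t n.+1) (U n x * V n x).
Proof.
move=> U2 V2; under eq_Rintegral do rewrite slabs_mul.
rewrite (Rintegral_sum _ _).2; last first.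
  move=> n _; apply: Lfun2_mul_integrable; apply: slab_Lfun2; [exact: U2|exact: V2].
by apply: eq_bigr => n _; have [] := Rintegral_slab_mul (t n) (t n.+1) (U2 n (ltn_ord n)) (V2 n (ltn_ord n)).
Qed.

End partition.
End slabs.

(** * Smooth functions of one variable that are flat at a point *)

Section flat_functions.
Context {R : realType}.
Implicit Types (P : {poly R}) (f g : R -> R).

(** For [P = 1] this is the classical [exp(-1/x)] extended by zero; the polynomial factor makes the
    family stable under differentiation. *)
Definition flat P (x : R) : R := if 0 < x then P.[x^-1] * expR (- x^-1) else 0.

(** Uses [y^(i+2) / (i+2)! <= exp y] at [y = 1/x]: the two spare powers give the factor [x ^+ 2],
    hence a zero derivative at 0. *)
Lemma flat_le P x : `|flat P x| <= (\sum_(i < size P) `|P`_i| * (i.+2)`!%:R) * x ^+ 2.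
Proof.
have C0 : 0 <= \sum_(i < size P) `|P`_i| * (i.+2)`!%:R.
  by apply: sumr_ge0 => i _; rewrite mulr_ge0.
rewrite /flat; case: ifPn => [x0|_]; last by rewrite normr0 mulr_ge0// sqr_ge0.
rewrite normrM (ger0_norm (expR_ge0 _)) horner_coef mulr_suml.
rewrite (le_trans (ler_wpM2r (expR_ge0 _) (ler_norm_sum _ _ _)))//.
rewrite mulr_suml ler_sum// => i _.
rewrite normrM -!mulrA ler_wpM2l//.
have xV0 : 0 < x^-1 by rewrite invr_gt0.
have xV0' := ltW xV0; rewrite ger0_norm ?exprn_ge0//.
rewrite expRN ler_pdivrMr ?expR_gt0//.
have h : x^-1 ^+ i.+2 / (i.+2)`!%:R <= expR x^-1.
  by rewrite (le_trans _ (expR_ge1Dxn i.+1 (ltW xV0)))// lerDr.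
rewrite ler_pdivrMr ?ltr0n ?fact_gt0// in h.
have -> : x^-1 ^+ i = x^-1 ^+ i.+2 * x ^+ 2.
  by rewrite -addn2 exprD -mulrA -exprMn mulVf ?gt_eqF// expr1n mulr1.
by rewrite [leRHS]mulrAC ler_wpM2r ?sqr_ge0// mulrC.
Qed.

(** The factor ['X^2] is the derivative of [-1/x] read in the variable [1/x]; the exponential
    contributes [P] and the polynomial factor minus its derivative. At 0, [flat_le] makes the
    difference quotients vanish. *)
Lemma is_derive_flat P (x : R) :
  is_derive x 1 (flat P) (flat ('X^2 * (P - P^`())) x).
Proof.
have [x0|x0|<-] := ltgtP 0 x.
- pose f (y : R) := P.[y^-1] * expR (- y^-1).
  have fE' : \near x, f x = flat P x.
    near=> y; rewrite /flat /f.
    have y0 : 0 < y by near: y; exact: lt_nbhsr.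
    by rewrite y0.
  have xn0 : x != 0 by rewrite gt_eqF.
  apply: (near_eq_is_derive fE').
  have dV : is_derive x (1 : R) (fun y : R => y^-1) (- x ^- 2).
    by have := is_deriveV xn0 (is_derive_id x (1 : R)); rewrite /= -[_ *: _]/(_ * _) mulr1.
  have dP := is_derive1_comp (is_derive_poly P x^-1) dV.
  have dN : is_derive x (1 : R) (fun y : R => - y^-1) (- - x ^- 2) by exact: is_deriveN.
  have dE : is_derive x (1 : R) (fun y : R => expR (- y^-1)) (expR (- x^-1) * - - x ^- 2).
    exact: (@is_derive1_comp _ expR (fun y => - y^-1)).
  have := is_deriveM dP dE; rewrite /flat x0.
  set u := (X in is_derive _ _ _ X -> _); set v := (X in _ -> is_derive _ _ _ X).
  suff -> : u = v by [].
  rewrite /u /v !(hornerM, hornerD, hornerN, hornerXn) -!exprVn /= -![_ *: _]/(_ * _).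
  by rewrite !hornerX; ring.
- have fE : \near x, (fun=> 0) x = flat P x.
    near=> y; rewrite /flat; have y0 : y < 0 by near: y; exact: lt_nbhsl.
    by rewrite ltNge (ltW y0).
  apply: (near_eq_is_derive fE); rewrite /flat ltNge (ltW x0)/=.
  exact: is_derive_cst.
- set C := \sum_(i < size P) `|P`_i| * (i.+2)`!%:R.
  have C0 : 0 <= C by apply: sumr_ge0 => i _; rewrite mulr_ge0.
  have q0 : (fun h => h^-1 *: ((flat P \o shift 0) (h *: 1) - flat P 0)) @ 0^' --> (0 : R).
    apply/cvgrPdist_lt => e e0; near=> h.
    have h0 : h != 0 by near: h; exact: nbhs_dnbhs_neq.
    have f0 : flat P 0 = 0 by rewrite /flat ltxx.
    rewrite /= addr0 -[h *: 1]/(h * 1) mulr1 f0 subr0 sub0r normrN.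
    rewrite -[_ *: _]/(_ * _) normrM normfV.
    rewrite (@le_lt_trans _ _ (C * `|h|))//.
      rewrite ler_pdivrMl ?normr_gt0// (le_trans (flat_le P h))//.
      by rewrite -/C [leRHS]mulrCA -expr2 real_normK ?num_real.
    rewrite (@le_lt_trans _ _ ((C + 1) * `|h|))//.
      by rewrite ler_wpM2r// lerDl.
    rewrite -ltr_pdivlMl; last by rewrite ltr_wpDl.
    near: h; apply: dnbhs0_lt; rewrite mulr_gt0// invr_gt0 ltr_wpDl//.
  apply: DeriveDef; first by apply/cvg_ex; exists 0.
  rewrite /derive; move/cvg_lim: q0 => -> //.
  by rewrite /flat ltxx.
Unshelve. all: by end_near.
Qed.

Fixpoint smooth1 k f : Prop :=
  if k is k'.+1 then (forall x : R, derivable f x 1) /\ smooth1 k' (derive1 f) else True.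

Lemma smooth1S k f : smooth1 k.+1 f -> smooth1 k f.
Proof.
elim: k f => // k IH f [df sf]; split => //; exact: IH.
Qed.

Lemma smooth1_flat k P : smooth1 k (flat P).
Proof.
elim: k P => // k IH P; split=> [x|]; first by have [] := is_derive_flat P x.
rewrite (_ : (derive1 _) = flat ('X^2 * (P - P^`())))//.
by apply/funext => x; rewrite derive1E; have [_ ->] := is_derive_flat P x.
Qed.

Lemma smooth1D k f g : smooth1 k f -> smooth1 k g -> smooth1 k (f \+ g).
Proof.
elim: k f g => // k IH f g [df sf] [dg sg]; split=> [x|]; first exact: derivableD.
rewrite (_ : (derive1 _) = (derive1 f) \+ (derive1 g)); first exact: IH.
by apply/funext => x; rewrite derive1E deriveD// /= !derive1E.
Qed.

Lemma smooth1M k f g : smooth1 k f -> smooth1 k g -> smooth1 k (f \* g).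
Proof.
elim: k f g => // k IH f g sf sg.
have [df sf'] := sf; have [dg sg'] := sg; split=> [x|]; first exact: derivableM.
rewrite (_ : (derive1 _) = (f \* (derive1 g)) \+ (g \* (derive1 f))).
  by apply: smooth1D; apply: IH => //; exact: smooth1S.
by apply/funext => x; rewrite derive1E deriveM// /= !derive1E.
Qed.

Lemma smooth1_cst k (c : R) : smooth1 k (fun=> c).
Proof.
elim: k c => // k IH c; split=> [x|]; first exact: derivable_cst.
rewrite (_ : (derive1 _) = fun=> 0)//.
by apply/funext => x; rewrite derive1E derive_cst.
Qed.

Lemma smooth1_affine k (c e : R) f : smooth1 k f -> smooth1 k (fun x => f (c * x + e)).
Proof.
elim: k f => // k IH f [df sf].
have dl (x : R) : is_derive x (1 : R) (fun x => c * x + e) c.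
  have -> : (fun x => c * x + e) = horner (c *: 'X + e%:P) by apply/funext => y; rewrite !hornerE.
  have := is_derive_poly (c *: 'X + e%:P) x.
  by rewrite derivD derivZ derivX derivC addr0 hornerZ hornerC mulr1.
have dc (x : R) : is_derive x (1 : R) (fun x => f (c * x + e)) ((derive1 f) (c * x + e) * c).
  have df' : is_derive (c * x + e) (1 : R) f ((derive1 f) (c * x + e)).
    by apply: DeriveDef => //; rewrite derive1E.
  exact: (@is_derive1_comp _ f (fun x => c * x + e)  _ _ _ df' (dl x)).
split=> [x|]; first by have [] := dc x.
rewrite (_ : (derive1 _) = (fun x => (derive1 f) (c * x + e)) \* (fun=> c)).
  by apply: smooth1M; [exact: IH|exact: smooth1_cst].
by apply/funext => x; rewrite derive1E; have [_ ->] := dc x.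
Qed.

End flat_functions.

(** * Boxes, open sets and measurability *)

Section boxes.
Context {R : realType} {d : nat}.
Implicit Types (a c x : 'rV[R]_d) (A : set 'rV[R]_d).

Definition box a c : set 'rV[R]_d := [set x | forall i, a ord0 i < x ord0 i < c ord0 i].

Definition cbox a c : set 'rV[R]_d := [set x | forall i, a ord0 i <= x ord0 i <= c ord0 i].

Lemma measurable_box a c : measurable (box a c).
Proof.
rewrite (_ : box a c = \bigcap_(i in [set: 'I_d]) (fun x => x ord0 i) @^-1` `]a ord0 i, c ord0 i[).
  apply: fin_bigcap_measurable => //= i _.
  rewrite -[X in measurable X]setTI; exact: measurable_coord.
apply/seteqP; split=> x; rewrite /box/=.
  by move=> ac i _ /=; rewrite in_itv/=.
by move=> ac i; have := ac i I; rewrite /= in_itv/=.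
Qed.

Lemma boxI a c a' c' : box a c `&` box a' c' =
  box (\row_i Num.max (a ord0 i) (a' ord0 i)) (\row_i Num.min (c ord0 i) (c' ord0 i)).
Proof.
apply/seteqP; split=> x /=; rewrite /box/=.
  move=> [h h'] i; rewrite !mxE gt_max lt_min.
  by have /andP[-> ->] := h i; have /andP[-> ->] := h' i.
move=> h; split=> i; have := h i; rewrite !mxE gt_max lt_min.
  by move=> /andP[/andP[-> _] /andP[-> _]].
by move=> /andP[/andP[_ ->] /andP[_ ->]].
Qed.

Lemma cbox_compact a c : compact (cbox a c).
Proof.
have -> : cbox a c = [set v | forall i, `[a ord0 i, c ord0 i]%classic (v ord0 i)].
  by apply/seteqP; split=> x h i; have := h i; rewrite /= in_itv/=.
apply: (@rV_compact R d (fun i => `[a ord0 i, c ord0 i]%classic)) => i.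
exact: segment_compact.
Qed.

Lemma closure_box a c : closure (box a c) `<=` cbox a c.
Proof.
rewrite [X in _ `<=` X](closure_id (cbox a c)).1.
  by apply: closureS => x h i; have /andP[/ltW -> /ltW ->] := h i.
by apply: compact_closed; [exact: norm_hausdorff|exact: cbox_compact].
Qed.

(** Balls of the sup norm are cubes, and the rationals are dense. The closed box is kept inside [O]
    because it will contain the support of a test function. *)
Lemma open_rat_box (O : set 'rV[R]_d) x : open O -> O x ->
  exists z : 'rV[rat]_d * 'rV[rat]_d,
    box (map_mx ratr z.1) (map_mx ratr z.2) x /\
    cbox (map_mx ratr z.1) (map_mx ratr z.2) `<=` O.
Proof.
move=> oO Ox; have /nbhs_ballP[e /= e0 eO] := open_nbhs_nbhs (conj oO Ox).
have /choice[a aP] i : exists r : rat, x ord0 i - e < ratr r < x ord0 i.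
  by have [r] := @rat_in_itvoo R (x ord0 i - e) (x ord0 i) (ltac:(rewrite ltrBlDr ltrDl//));
    rewrite in_itv/= => ?; exists r.
have /choice[c cP] i : exists r : rat, x ord0 i < ratr r < x ord0 i + e.
  by have [r] := @rat_in_itvoo R (x ord0 i) (x ord0 i + e) (ltac:(rewrite ltrDl//));
    rewrite in_itv/= => ?; exists r.
exists (\row_i a i, \row_i c i); split.
  by move=> i; rewrite !mxE; have /andP[_ ->] := aP i; have /andP[-> _] := cP i.
move=> y yac; apply: eO; split => // i j; rewrite !ord1 {i}.
have := yac j; rewrite !mxE => /andP[h1 h2].
have /andP[a1 _] := aP j; have /andP[_ c2] := cP j.
rewrite /ball/= ltr_distl; apply/andP; split; lra.
Qed.

(** The sigma-algebra is generated by coordinates rather than by the topology; the countable family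
    of rational boxes links the two. *)
Lemma measurable_open (O : set 'rV[R]_d) : open O -> measurable O.
Proof.
move=> oO.
pose B (z : 'rV[rat]_d * 'rV[rat]_d) : set 'rV[R]_d :=
  box (map_mx ratr z.1) (map_mx ratr z.2).
pose S := [set z : 'rV[rat]_d * 'rV[rat]_d | B z `<=` O].
have -> : O = \bigcup_(z in S) B z.
  apply/seteqP; split=> [x Ox|x [z /= zO zx]]; last exact: zO.
  have [z [zx zO]] := open_rat_box oO Ox; exists z => //.
  by move=> y zy; apply: zO => i; have /andP[/ltW -> /ltW ->] := zy i.
rewrite bigcup_mkcond; apply: countable_bigcupT_measurable; first exact: countableP.
by move=> z; case: ifP => _ //; exact: measurable_box.
Qed.

Lemma measurable_continuous (f : 'rV[R]_d -> R) : continuous f -> measurable_fun setT f.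
Proof.
move=> cf; apply: (measurability _ (RGenOInfty.measurableE R)) => //.
move=> _ [_ [x ->] <-]; rewrite setTI; apply: measurable_open.
by apply: open_comp => // *; exact: cf.
Qed.

End boxes.

Lemma leb_box_lty (R : realType) d (a c : 'rV[R]_d) : (leb d (box a c) < +oo)%E.
Proof.
elim: d a c => [|d IH] a c.
  by rewrite /= diracE; case: (_ \in _); rewrite ltry.
pose a' : 'rV[R]_d := @rsubmx R 1 1 d a; pose c' : 'rV[R]_d := @rsubmx R 1 1 d c.
have sub : @row_cons R d @^-1` box a c `<=` `]a ord0 ord0, c ord0 ord0[%classic `*` box a' c'.
  move=> [x y] h; split => /=.
    have := h ord0; rewrite in_itv /=.
    suff -> : @row_cons R d (x, y) ord0 ord0 = x by [].
    by have [->] := row_consK (x, y).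
  move=> i; have := h (rshift 1 i).
  have -> : @row_cons R d (x, y) ord0 (rshift 1 i) = y ord0 i by exact: row_mxEr.
  by rewrite /a' /c' !mxE.
have mP : measurable (`]a ord0 ord0, c ord0 ord0[%classic `*` box a' c').
  by apply: measurableX => //; exact: measurable_box.
rewrite /= /pushforward.
apply: (@le_lt_trans _ _ ((lebesgue_measure \x leb d)%E (`]a ord0 ord0, c ord0 ord0[%classic `*` box a' c'))).
  apply: le_measure; rewrite ?inE//.
  rewrite -[X in measurable X]setTI; apply: measurable_row_cons => //.
  exact: measurable_box.
rewrite product_measure1E//; last exact: measurable_box.
apply: lte_mul_pinfty => //.
- rewrite ge0_fin_numE//; have := @lebesgue_measure_itv R `]a ord0 ord0, c ord0 ord0[.
  by move=> /= ->; case: ifP => _; rewrite ?ltry.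
- exact: IH.
Qed.

(** * Smooth bumps that approximate the indicator of a box *)

Section tensor_products.
Context {R : realType} {d : nat}.
Implicit Types (f : 'I_d -> R -> R).

Definition tensor f (x : 'rV[R]_d) : R := \prod_i f i (x ord0 i).

Lemma differentiable_tensor f x : (forall i (y : R), derivable (f i) y 1) ->
  differentiable (tensor f) x.
Proof.
move=> df; rewrite /tensor.
elim: (index_enum _) => [|i r IH].
  under eq_fun do rewrite big_nil; exact: differentiable_cst.
under eq_fun do rewrite big_cons.
apply: differentiableM => //.
apply: (@differentiable_comp _ _ _ _ (fun x : 'rV[R]_d => x ord0 i) (f i)).
  exact: differentiable_coord.
exact/derivable1_diffP.
Qed.

(** One factor is replaced by its derivative, so products of smooth factors are stable under
    [partial]; this drives the induction in [Ck_tensor]. *)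
Lemma partial_tensor f j : (forall i (y : R), derivable (f i) y 1) ->
  partial j (tensor f) = tensor (fun i => if i == j then derive1 (f j) else f i).
Proof.
move=> df; apply/funext => x; rewrite /partial /derive.
have H : (fun h => h^-1 *: ((tensor f \o shift x) (h *: delta_mx ord0 j) - tensor f x)) =
  (fun h => (h^-1 *: (f j (h + x ord0 j) - f j (x ord0 j))) * \prod_(i | i != j) f i (x ord0 i)).
  apply/funext => h; rewrite /= /tensor (bigD1 j)//= [X in _ - X](bigD1 j)//=.
  rewrite (eq_bigr (fun i => f i (x ord0 i))); last first.
    by move=> i /negbTE ij; rewrite !mxE eqxx ij/= mulr0 add0r.
  by rewrite !mxE !eqxx mulr1 -mulrBl -![_ *: _]/(_ * _) mulrA.
apply/cvg_lim; first exact: Rhausdorff.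
have -> : tensor (fun i => if i == j then derive1 (f j) else f i) x =
    derive1 (f j) (x ord0 j) * \prod_(i | i != j) f i (x ord0 i).
  rewrite /tensor (bigD1 j)//= eqxx; congr (_ * _).
  by apply: eq_bigr => i /negbTE ->.
rewrite H.
apply: cvgMr_tmp; rewrite derive1E.
have := df j (x ord0 j); rewrite /derivable /derive.
set G := (X in cvg (X @ _) -> _); rewrite (_ : (fun h : R => _) = G)//.
by apply/funext => h; rewrite /G /= -[h *: 1]/(h * 1) mulr1.
Qed.

Lemma Ck_tensor f k : (forall i k', smooth1 k' (f i)) -> Ck k (tensor f).
Proof.
have df (g : 'I_d -> R -> R) : (forall i k', smooth1 k' (g i)) -> forall i (y : R), derivable (g i) y 1.
  by move=> sg i y; have [] := sg i 1.
elim: k f => [|k IH] f sf /=.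
  by move=> x; apply: differentiable_continuous; apply: differentiable_tensor; exact: df.
split=> [x|j]; first by apply: differentiable_tensor; exact: df.
rewrite partial_tensor; last exact: df.
apply: IH => i k'; case: ifP => _; last exact: sf.
by have [] := sf j k'.+1.
Qed.

(** The two flat factors vanish outside of []a, c[], and the steepness [n.+1] makes their product
    tend to 1 inside as [n] grows. *)
Definition bump1 (n : nat) (a c y : R) : R :=
  flat 1 (n.+1%:R * y + - (n.+1%:R * a)) * flat 1 (- n.+1%:R * y + n.+1%:R * c).

Definition bump n (a c : 'rV[R]_d) : 'rV[R]_d -> R :=
  tensor (fun i => bump1 n (a ord0 i) (c ord0 i)).

Lemma flat1_ge0_le1 (x : R) : 0 <= flat 1 x <= 1.
Proof.
rewrite /flat hornerC mul1r; case: ifPn => [x0|_]; last by rewrite lexx ler01.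
by rewrite expR_ge0 expR_le1 oppr_le0 invr_ge0 ltW.
Qed.

Lemma bump1_ge0_le1 n (a c y : R) : 0 <= bump1 n a c y <= 1.
Proof.
rewrite /bump1; set A := flat _ _; set B := flat _ _.
have /andP[A0 A1] : 0 <= A <= 1 by exact: flat1_ge0_le1.
have /andP[B0 B1] : 0 <= B <= 1 by exact: flat1_ge0_le1.
by rewrite mulr_ge0//= mulr_ile1.
Qed.

Lemma bump1_eq0 n (a c y : R) : ~~ (a < y < c) -> bump1 n a c y = 0.
Proof.
rewrite negb_and /bump1 /flat -mulrBr (_ : - _ * y + _ = n.+1%:R * (c - y)); last by ring.
rewrite !pmulr_rgt0// !subr_gt0.
by case/orP => /negbTE ->; rewrite ?mul0r ?mulr0.
Qed.

Lemma bump_ge0_le1 n a c x : 0 <= bump n a c x <= 1.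
Proof.
rewrite /bump /tensor; apply/andP; split.
  by apply: prodr_ge0 => i _; have /andP[] := bump1_ge0_le1 n (a ord0 i) (c ord0 i) (x ord0 i).
have : 0 <= \prod_i bump1 n (a ord0 i) (c ord0 i) (x ord0 i) <= 1; last by case/andP.
apply: (big_ind (fun y : R => 0 <= y <= 1)); first by rewrite ler01 lexx.
  by move=> y z /andP[y0 y1] /andP[z0 z1]; rewrite mulr_ge0//= mulr_ile1.
by move=> i _; exact: bump1_ge0_le1.
Qed.

Lemma bump_out n a c x : ~ box a c x -> bump n a c x = 0.
Proof.
move=> /existsNP[i /negP xi]; by rewrite /bump /tensor (bigD1 i)//= bump1_eq0// mul0r.
Qed.

Lemma bump_cvg a c x : bump n a c x @[n --> \oo] --> (\1_(box a c) x : R).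
Proof.
rewrite indicE; case: (boolP (x \in _)) => [/set_mem xb|/negP xb]; last first.
  rewrite (_ : (fun n => _) = fun=> 0); first exact: cvg_cst.
  by apply/funext => n; rewrite bump_out// => /mem_set.
have flat_cvg (y : R) : 0 < y -> (fun n => flat 1 (n.+1%:R * y)) @ \oo --> (1 : R).
  move=> y0.
  have -> : (fun n => flat 1 (n.+1%:R * y)) = (fun n => expR (- (n.+1%:R^-1 * y^-1))).
    by apply/funext => n; rewrite /flat pmulr_rgt0// y0 hornerC mul1r invfM.
  rewrite -[X in _ --> X]expR0; apply: continuous_cvg; first exact: continuous_expR.
  rewrite -[X in _ --> X]oppr0; apply: cvgN.
  have := @cvgMr_tmp R _ _ _ _ _ y^-1 (@cvg_harmonic R); by rewrite mul0r; apply.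
have -> : true%:R = \prod_(i < d) (1 : R) by rewrite big1.
apply: cvg_big => [|i _]; first exact: mul_continuous.
have /andP[ax xc] := xb i.
rewrite -[X in _ --> X]mulr1 /bump1; apply: cvgM.
  under eq_fun do rewrite -mulrBr; apply: flat_cvg; by rewrite subr_gt0.
rewrite (_ : (fun n => _) = fun n => flat 1 (n.+1%:R * (c ord0 i - x ord0 i))).
  by apply: flat_cvg; rewrite subr_gt0.
by apply/funext => n; congr flat; ring.
Qed.

Lemma test_function_bump n a c (O : set 'rV[R]_d) : cbox a c `<=` O ->
  test_function O (bump n a c).
Proof.
move=> acO; have sub : closure [set x | bump n a c x != 0] `<=` cbox a c.
  apply: subset_trans (@closure_box _ _ a c); apply: closureS => x /=.
  by move=> bx; apply: contrapT => /bump_out xb; rewrite xb eqxx in bx.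
split=> [k||]; last exact: subset_trans sub acO.
  by apply: Ck_tensor => i k'; apply: smooth1M; apply: smooth1_affine; exact: smooth1_flat.
apply: subclosed_compact (@cbox_compact _ _ a c) sub; exact: closed_closure.
Qed.

Lemma bump_Lfun2 n a c : bump n a c \in Lfun (leb d) 2%:E.
Proof.
have mb : measurable_fun setT (bump n a c).
  apply: measurable_continuous; have [Cb _ _] := @test_function_bump n a c setT (fun _ _ => I).
  exact: (Cb 0).
apply/Lfun2P; split => //; apply: (@le_integrable _ _ _ _ _ _ _ (EFin \o \1_(box a c))) => //.
- by apply/measurable_EFinP; exact: measurable_funX.
- move=> x _ /=; rewrite lee_fin indicE.
  have /andP[b0 b1] := bump_ge0_le1 n a c x.
  rewrite !ger0_norm ?sqr_ge0//; case: (boolP (x \in _)) => [_|/negP xb].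
    by rewrite exprn_ile1.
  by rewrite bump_out ?expr0n// => /mem_set.
- apply/integrableP; split.
    by apply/measurable_EFinP; apply: measurable_indic; exact: measurable_box.
  under eq_integral do rewrite /= ger0_norm//.
  by rewrite integral_indic ?setIT//; [exact: leb_box_lty|exact: measurable_box].
Qed.

End tensor_products.

(** * The fundamental lemma of the calculus of variations *)

Section fundamental_lemma.
Context {R : realType} {d : nat}.
Local Notation mu := (leb d : set 'rV[R]_d -> \bar R).

Lemma indic_box_Lfun2 (a c : 'rV[R]_d) : (\1_(box a c) : 'rV[R]_d -> R) \in Lfun mu 2%:E.
Proof.
apply/Lfun2P; split; first by apply: measurable_indic; exact: measurable_box.
apply/integrableP; split.
  by apply/measurable_EFinP; apply: measurable_funX; apply: measurable_indic; exact: measurable_box.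
rewrite (eq_integral (fun x => (\1_(box a c) x)%:E)).
  by rewrite integral_indic ?setIT//; [exact: leb_box_lty|exact: measurable_box].
move=> x _ /=; rewrite ger0_norm ?sqr_ge0// indicE.
by case: (_ \in _); rewrite ?expr1n ?expr0n.
Qed.

Variables (O : set 'rV[R]_d) (h : 'rV[R]_d -> R).
Hypothesis oO : open O.
Hypothesis h2 : h \in Lfun mu 2%:E.
Hypothesis h_orth : forall phi, test_function O phi -> phi \in Lfun mu 2%:E ->
  \int[mu]_x (h x * phi x) = 0.

Let hbox_integrable a c : mu.-integrable setT (fun x => (h x * \1_(box a c) x)%:E).
Proof. by apply: Lfun2_mul_integrable => //; exact: indic_box_Lfun2. Qed.

(** Dominated convergence along the bumps, which lie between 0 and the indicator of the box. *)
Lemma integral_box_eq0 a c : cbox a c `<=` O ->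
  (\int[mu]_x (h x * \1_(box a c) x)%:E = 0)%E.
Proof.
move=> acO; have mh := Lfun2_measurable h2.
have ib n : mu.-integrable setT (fun x => (h x * bump n a c x)%:E).
  by apply: Lfun2_mul_integrable => //; exact: bump_Lfun2.
have [|||||_ _ cv] := @dominated_convergence _ _ _ mu setT measurableT
  (fun n x => (h x * bump n a c x)%:E) (fun x => (h x * \1_(box a c) x)%:E)
  (fun x => (`|h x * \1_(box a c) x|)%:E).
- by move=> n; exact: measurable_int (ib n).
- exact: measurable_int (hbox_integrable a c).
- apply: aeW => x _; apply: cvg_EFin; first exact: nearW.
  by apply: cvgMl_tmp; exact: bump_cvg.
- exact: integrable_abse (hbox_integrable a c).
- apply: aeW => x n _; rewrite lee_fin !normrM ler_wpM2l//.
  have /andP[b0 b1] := bump_ge0_le1 n a c x.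
  rewrite !ger0_norm// indicE; case: (boolP (x \in _)) => // /negP xb.
  by rewrite bump_out// => /mem_set.
have : (fun n : nat => 0%E : \bar R) @ \oo --> (\int[mu]_x (h x * \1_(box a c) x)%:E)%E.
  have -> // : (fun n : nat => 0%E : \bar R) = (fun n => \int[mu]_x (h x * bump n a c x)%:E)%E.
  apply/funext => n.
  rewrite -[LHS]/(0%:E) -(h_orth (test_function_bump n acO) (bump_Lfun2 n a c)).
  by rewrite /Rintegral fineK//; apply: integrable_fin_num => //; exact: ib.
by move=> /cvg_lim <- //; rewrite lim_cst.
Qed.

Let boxes : set_system 'rV[R]_d := [set A | exists a c, A = box a c].

(** A coordinate half space is a countable union of bounded boxes. *)
Lemma measurable_rV_boxes : @measurable _ 'rV[R]_d = <<s boxes >>.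
Proof.
apply/seteqP; split; last first.
  apply: smallest_sub; first exact: sigma_algebra_measurable.
  by move=> _ [a [c ->]]; exact: measurable_box.
pose GT := g_sigma_algebraType boxes.
have mid : measurable_fun [set: GT] (id : GT -> 'rV[R]_d).
  apply: measurable_fun_rVP => i.
  apply: (measurability _ (RGenOInfty.measurableE R)) => //.
  move=> _ [_ [y ->] <-]; rewrite setTI.
  have -> : (fun x : GT => id x ord0 i) @^-1` `]y, +oo[%classic =
    \bigcup_n box (\row_j (if j == i then y else - n%:R)) (const_mx n%:R).
    apply/seteqP; split=> x /=; rewrite in_itv/= andbT; last first.
      by move=> [n _ /(_ i)]; rewrite !mxE eqxx => /andP[].
    move=> yx.
    pose M := \sum_j `|x ord0 j|.
    have [n nM] : exists n : nat, M < n%:R.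
      by exists (Num.truncn M).+1; rewrite truncnS_gt.
    exists n => // j; rewrite !mxE.
    have xM : `|x ord0 j| < n%:R.
      apply: le_lt_trans nM; rewrite /M (bigD1 j)//= lerDl.
      by apply: sumr_ge0.
    move: xM; rewrite ltr_norml => /andP[x1 x2]; rewrite x2 andbT.
    by case: eqP => // ->.
  apply: bigcup_measurable => n _; apply: sub_sigma_algebra.
  by eexists; eexists.
move=> A mA; have := mid measurableT A mA; rewrite setTI; exact.
Qed.

(** Boxes are stable under intersection, and the sets over which [H] has zero integral are stable
    under complement and disjoint union. By Dynkin's theorem every measurable set is one of them, so
    [H] vanishes almost everywhere. *)
Let hbox_ae a c : cbox a c `<=` O -> {ae mu, forall x, box a c x -> h x = 0}.
Proof.
move=> acO.
have mh := Lfun2_measurable h2.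
set H : 'rV[R]_d -> \bar R := fun x => (h x * \1_(box a c) x)%:E.
have iH : mu.-integrable setT H by exact: hbox_integrable.
have H0 A : measurable A -> (\int[mu]_(x in A) H x = 0)%E.
  rewrite measurable_rV_boxes; move: A; apply: (@dynkin_induction _ _ boxes (fun A => (\int[mu]_(x in A) H x = 0)%E) measurable_rV_boxes).
  - by move=> _ _ [a1 [c1 ->]] [a2 [c2 ->]]; rewrite boxI; do 2 eexists.
  - exact: integral_box_eq0.
  - move=> _ [a1 [c1 ->]]; rewrite integral_mkcond.
    transitivity (\int[mu]_x (h x * \1_(box a1 c1 `&` box a c) x)%:E)%E.
      apply: eq_integral => x _; rewrite patchE /H !indicE in_setI.
      by case: (_ \in _) => //=; rewrite mulr0.
    rewrite boxI; apply: integral_box_eq0 => x xb; apply: acO => i.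
    have := xb i; rewrite !mxE ge_max le_min.
    by move=> /andP[/andP[_ ->] /andP[_ ->]].
  - move=> S mS S0; have mSC := measurableC mS.
    have := integral_box_eq0 acO; rewrite -/H -(setUv S) integral_setU//=.
    + by rewrite S0 add0e.
    + by rewrite setUv; exact: measurable_int iH.
    + by apply/disj_setPS; rewrite setICr.
  - move=> F mF tF F0.
    rewrite integral_bigcup//; last by apply: integrableS iH => //; exact: bigcup_measurable.
    by apply: eseries0 => n _ _; exact: F0.
have : ae_eq mu setT H (cst 0%E).
  apply: integral_ae_eq => // E _ mE; by rewrite H0// integral0.
apply: filterS => x /(_ I) Hx xb; move: Hx.
by rewrite /H /= indicE mem_set// mulr1 => -[].
Qed.

(* The indicator of a box is a bounded limit of test functions, and the boxes
   generate the Borel sets. *)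
Lemma test_orthogonal_eq0 : {ae mu, forall x, O x -> h x = 0}.
Proof.
pose B (z : 'rV[rat]_d * 'rV[rat]_d) : set 'rV[R]_d :=
  box (map_mx ratr z.1) (map_mx ratr z.2).
pose CB (z : 'rV[rat]_d * 'rV[rat]_d) : set 'rV[R]_d :=
  cbox (map_mx ratr z.1) (map_mx ratr z.2).
(* An enumeration of the rational boxes; a number that codes no box, or a box that leaves [O], gives
   the empty set. *)
pose F (n : nat) : set 'rV[R]_d :=
  if unpickle n is Some z then [set x | CB z `<=` O /\ B z x /\ h x <> 0] else set0.
have nF n : mu.-negligible (F n).
  rewrite /F; case: (unpickle n) => [z|]; last exact: negligible_set0.
  have [zO|zO] := pselect (CB z `<=` O); last first.
    apply: (negligibleS _ (negligible_set0 mu)) => x [] //.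
  apply: negligibleS (hbox_ae zO) => x /= [_ [Bx hx]] /(_ Bx); exact: hx.
apply: negligibleS (negligible_bigcup nF) => x /= /not_implyP[Ox hx].
have [z [zx zO]] := open_rat_box oO Ox.
by exists (pickle z) => //; rewrite /F pickleK.
Qed.

End fundamental_lemma.

(** * Stability of test functions under combinations and derivatives *)

Section test_functions.
Context {R : realType} {d : nat}.
Variable O : set 'rV[R]_d.
Implicit Types (phi psi v : 'rV[R]_d -> R) (g : 'rV[R]_d -> 'rV[R]_d).
Local Notation mu := (leb d : set 'rV[R]_d -> \bar R).

Lemma partial_axpy i (c : R) phi psi x :
  (forall x, differentiable phi x) -> (forall x, differentiable psi x) ->
  partial i (fun x => c * phi x + psi x) x = c * partial i phi x + partial i psi x.
Proof.
move=> dphi dpsi; rewrite /partial.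
rewrite (@deriveD _ _ _ (fun x => c * phi x) psi x); last 2 first.
- by apply: diff_derivable; exact: differentiableZ.
- exact: diff_derivable.
by rewrite (@deriveZ _ _ _ phi c); last exact: diff_derivable.
Qed.

Lemma Ck_axpy k (c : R) phi psi : Ck k phi -> Ck k psi ->
  Ck k (fun x => c * phi x + psi x).
Proof.
elim: k phi psi => [|k IH] phi psi /=.
  move=> cphi cpsi x.
  exact: (cvgD (@cvgMl_tmp _ _ _ _ _ c _ (cphi x)) (cpsi x)).
move=> [dphi phi'] [dpsi psi']; split=> [x|i].
  apply: differentiableD => //; exact: differentiableZ.
rewrite (_ : partial i _ = (fun x => c * partial i phi x + partial i psi x)); first exact: IH.
by apply/funext => x; exact: partial_axpy.
Qed.

Lemma test_function_axpy (c : R) phi psi : test_function O phi -> test_function O psi ->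
  test_function O (fun x => c * phi x + psi x).
Proof.
move=> [Cphi Kphi phiO] [Cpsi Kpsi psiO].
have sub : closure [set x | c * phi x + psi x != 0] `<=`
    closure [set x | phi x != 0] `|` closure [set x | psi x != 0].
  rewrite -closureU; apply: closureS => x /= h.
  by have [phi0|] := eqVneq (phi x) 0; [right; rewrite phi0 mulr0 add0r in h|left].
split=> [k||]; first exact: Ck_axpy.
  apply: subclosed_compact (compactU Kphi Kpsi) sub; exact: closed_closure.
by move=> x /sub[/phiO|/psiO].
Qed.

Lemma test_function0 : test_function O (fun=> 0).
Proof.
have S0 : [set x : 'rV[R]_d | (0 : R) != 0] = set0.
  by rewrite -subset0 => x /=; rewrite eqxx.
split; last 2 first.
- by rewrite S0 closure0; exact: compact0.
- by rewrite S0 closure0.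
elim=> [|k IH] /=; first exact: cst_continuous.
split=> [x|i]; first exact: differentiable_cst.
rewrite (_ : partial i _ = fun=> 0)//; apply/funext => x; exact: derive_cst.
Qed.

(** Off its closed support [phi] vanishes on a neighbourhood, hence so do its derivatives. *)
Lemma test_function_partial i phi : test_function O phi -> test_function O (partial i phi).
Proof.
move=> [Cphi Kphi phiO].
have sub : closure [set x | partial i phi x != 0] `<=` closure [set x | phi x != 0].
  rewrite [X in _ `<=` X](closure_id (closure [set x | phi x != 0])).1; last exact: closed_closure.
  apply: closureS => x /= dx; apply: contrapT => xS.
  have oS : open (~` closure [set x | phi x != 0]) by apply: closed_openC; exact: closed_closure.
  have near0 : \near x, (fun=> 0) x = phi x.
    have : nbhs x (~` closure [set x | phi x != 0]) by apply: open_nbhs_nbhs.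
    apply: filterS => y yS; apply/esym/eqP/negPn/negP => y0; apply: yS.
    exact: subset_closure.
  by move: dx; rewrite /partial -(near_eq_derive _ near0) derive_cst eqxx.
split=> [k||]; first by have [_ +] := Cphi k.+1; exact.
  apply: subclosed_compact Kphi sub; exact: closed_closure.
exact: subset_trans sub phiO.
Qed.

(** Being continuous with compact support, [phi] is dominated by a multiple of the indicator of a
    bounded box. *)
Lemma test_function_Lfun2 phi : test_function O phi -> phi \in Lfun mu 2%:E.
Proof.
move=> [Cphi Kphi _]; set S := closure _ in Kphi.
have cphi : continuous phi := Cphi 0.
have mphi := measurable_continuous cphi.
have bnd (f : 'rV[R]_d -> R) : continuous f -> exists M : R, forall x, S x -> `|f x| < M.
  move=> cf; have Kim : compact (f @` S).
    by apply: continuous_compact Kphi; exact: continuous_subspaceT.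
  have /compact_bounded[M [_ MP]] := Kim; exists (M + 2) => x Sx.
  rewrite (@le_lt_trans _ _ (M + 1))//; last by rewrite ltrD2l ltr1n.
  by apply: MP; [rewrite ltrDl|exists x].
have /choice[M MP] i : exists M : R, forall x, S x -> `|x ord0 i| < M.
  by apply: bnd; exact: coord_continuous.
have [m' m'P] := bnd _ cphi.
pose c : 'rV[R]_d := \row_i M i.
apply/Lfun2P; split => //.
apply: (@le_integrable _ _ _ _ _ _ _ (EFin \o (fun x => (m' * \1_(box (- c) c) x) ^+ 2))) => //.
- by apply/measurable_EFinP; exact: measurable_funX.
- move=> x _ /=; rewrite lee_fin !ger0_norm ?sqr_ge0//.
  have [xS|xS] := pselect (S x); last first.
    have -> : phi x = 0.
      by apply/eqP/negPn/negP => h; apply: xS; exact: subset_closure.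
    by rewrite expr0n/= sqr_ge0.
  have xb : box (- c) c x.
    by move=> i; rewrite !mxE -ltr_norml MP.
  rewrite indicE mem_set// mulr1.
  have phim := ltW (m'P x xS).
  by rewrite -real_normK ?num_real// lerXn2r ?nnegrE// (le_trans _ phim).
- by apply: Lfun2_integrable_sqr; apply: Lfun2Z; exact: indic_box_Lfun2.
Qed.

End test_functions.

Section restrictions.
Context {disp : measure_display} {X : measurableType disp} {R : realType}.
Variables (mu : {measure set X -> \bar R}) (D : set X).
Implicit Types f g : X -> R.

Lemma restrict_axpy (c : R) f g :
  (fun x => c * f x + g x) \_ D = fun x => c * (f \_ D) x + (g \_ D) x.
Proof. by apply/funext => x; rewrite !patchE; case: ifP => // _; rewrite mulr0 addr0. Qed.

Lemma L2_axpy (c : R) f g : L2 mu D f -> L2 mu D g -> L2 mu D (fun x => c * f x + g x).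
Proof. by move=> f2 g2; rewrite /L2/= restrict_axpy; exact: Lfun2_axpy. Qed.

Lemma L2ipE f g : L2ip mu D f g = \int[mu]_x ((f \_ D) x * (g \_ D) x).
Proof.
rewrite /L2ip Rintegral_mkcond; apply: eq_Rintegral => x _.
by rewrite !patchE; case: ifP => // _; rewrite mul0r.
Qed.

Lemma L2ipEl f g : L2ip mu D f g = \int[mu]_x ((f \_ D) x * g x).
Proof.
rewrite /L2ip Rintegral_mkcond; apply: eq_Rintegral => x _.
by rewrite !patchE; case: ifP => // _; rewrite mul0r.
Qed.

Lemma L2norm_sqr f : (L2norm mu D f ^+ 2 = \int[mu]_x ((f \_ D) x ^+ 2)%:E)%E.
Proof. exact: Lnorm2_sqr. Qed.

Lemma L2norm_ltP f (e : R) : 0 < e ->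
  (L2norm mu D f < e%:E)%E <-> (\int[mu]_x ((f \_ D) x ^+ 2)%:E < (e ^+ 2)%:E)%E.
Proof.
move=> e0; rewrite -L2norm_sqr; have := Lnorm_ge0 mu 2%:E (EFin \o (f \_ D)).
rewrite -/(L2norm mu D f); case: (L2norm mu D f) => [r| |]//.
rewrite lee_fin => r0; rewrite -EFin_expe !lte_fin.
by rewrite ltr_pXn2r// ?nnegrE// ltW.
Qed.

End restrictions.

(** * Weak gradients and the linear structure of [H10] *)

Section weak_gradients.
Context {R : realType} {d : nat}.
Variable O : set 'rV[R]_d.
Implicit Types (phi psi v : 'rV[R]_d -> R) (g : 'rV[R]_d -> 'rV[R]_d).
Local Notation mu := (leb d : set 'rV[R]_d -> \bar R).

(** The difference of two gradients, extended by zero, is orthogonal to every test function. *)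
Lemma weak_grad_unique v g1 g2 : open O -> is_weak_grad O v g1 -> is_weak_grad O v g2 ->
  {ae mu, forall x, O x -> g1 x = g2 x}.
Proof.
move=> oO [v2 g12 w1] [_ g22 w2].
have H i : {ae mu, forall x, O x -> g1 x ord0 i = g2 x ord0 i}.
  pose h : 'rV[R]_d -> R := (fun x => (-1) * g2 x ord0 i + g1 x ord0 i) \_ O.
  have h2 : h \in Lfun mu 2%:E by exact: (L2_axpy (-1) (g22 i) (g12 i)).
  have h_orth phi : test_function O phi -> phi \in Lfun mu 2%:E -> \int[mu]_x (h x * phi x) = 0.
    move=> tphi phi2; rewrite /h restrict_axpy.
    under eq_Rintegral do rewrite mulN1r mulrDl mulNr addrC.
    have i1 := Lfun2_mul_integrable (g12 i) phi2.
    have i2 := Lfun2_mul_integrable (g22 i) phi2.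
    rewrite RintegralB//.
    by rewrite -!L2ipEl; apply/eqP; rewrite subr_eq0 -eqr_opp -w1// -w2.
  apply: filterS (test_orthogonal_eq0 oO h2 h_orth) => x + Ox.
  move=> /(_ Ox); rewrite /h patchE mem_set// mulN1r addrC => /eqP.
  by rewrite subr_eq0 => /eqP.
apply: filterS (filter_forall _ H) => x Hx Ox.
by apply/rowP => i; exact: Hx.
Qed.

Lemma is_weak_grad_axpy (c : R) v1 v2 g1 g2 : is_weak_grad O v1 g1 -> is_weak_grad O v2 g2 ->
  is_weak_grad O (fun x => c * v1 x + v2 x) (fun x => c *: g1 x + g2 x).
Proof.
move=> [v12 g12 w1] [v22 g22 w2]; split=> [|i|phi tphi i]; first exact: L2_axpy.
  by under eq_fun do rewrite !mxE; exact: (L2_axpy c (g12 i) (g22 i)).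
have phi2 := test_function_Lfun2 tphi.
have dphi2 := test_function_Lfun2 (test_function_partial i tphi).
have lin f h psi : L2 mu O f -> L2 mu O h -> psi \in Lfun mu 2%:E ->
  L2ip mu O (fun x => c * f x + h x) psi = c * L2ip mu O f psi + L2ip mu O h psi.
  move=> f2 h2 psi2; rewrite !L2ipEl restrict_axpy.
  have fi := Lfun2_mul_integrable f2 psi2; have hi := Lfun2_mul_integrable h2 psi2.
  under eq_Rintegral do rewrite mulrDl -mulrA.
  rewrite RintegralD//; first by rewrite RintegralZl.
  exact: (integrableZl measurableT _ fi).
rewrite lin// w1// w2// mulrN -opprD; congr (- _).
rewrite -(lin (fun x => g1 x ord0 i) (fun x => g2 x ord0 i))//.
by apply: eq_Rintegral => x _; rewrite !mxE.
Qed.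

Lemma is_weak_grad0 : is_weak_grad O (fun=> 0) (fun=> 0).
Proof.
have L0 : L2 mu O (fun=> 0).
  rewrite /L2/= (_ : _ \_ _ = fun=> 0); first exact: Lfun2_0.
  by apply/funext => x; rewrite patchE; case: ifP.
split=> [//|i|phi tphi i].
  by under eq_fun do rewrite mxE.
rewrite /L2ip; under eq_Rintegral do rewrite mul0r.
under [in RHS]eq_Rintegral do rewrite mxE mul0r.
by rewrite /Rintegral !integral0 /= oppr0.
Qed.

Lemma is_weak_grad_sum I (r : seq I) (c : I -> R) (v : I -> 'rV[R]_d -> R)
    (g : I -> 'rV[R]_d -> 'rV[R]_d) :
  (forall i, is_weak_grad O (v i) (g i)) ->
  is_weak_grad O (fun x => \sum_(i <- r) c i * v i x) (fun x => \sum_(i <- r) c i *: g i x).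
Proof.
move=> vg; elim: r => [|i r IH].
  under eq_fun do rewrite big_nil; under [X in is_weak_grad _ _ X]eq_fun do rewrite big_nil.
  exact: is_weak_grad0.
under eq_fun do rewrite big_cons; under [X in is_weak_grad _ _ X]eq_fun do rewrite big_cons.
exact: is_weak_grad_axpy.
Qed.

Lemma sqr_enorm (x : 'rV[R]_d) : enorm x ^+ 2 = \sum_i x ord0 i ^+ 2.
Proof.
rewrite /enorm sqr_sqrtr; last by apply: sumr_ge0 => i _; rewrite -expr2 sqr_ge0.
by apply: eq_bigr => i _; rewrite expr2.
Qed.

Lemma sqr_enorm_restrict g x :
  ((fun x => enorm (g x)) \_ O) x ^+ 2 = \sum_i ((fun x => g x ord0 i) \_ O) x ^+ 2.
Proof.
rewrite patchE; case: ifP => xO; first by rewrite sqr_enorm; apply: eq_bigr => i _; rewrite patchE xO.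
by rewrite expr0n big1// => i _; rewrite patchE xO expr0n.
Qed.

Lemma L2_sub_test v phi : L2 mu O v -> test_function O phi ->
  (v \- phi) \_ O \in Lfun mu 2%:E.
Proof.
move=> v2 tphi.
have -> : v \- phi = (fun x => (-1) * phi x + v x).
  by apply/funext => x /=; rewrite mulN1r addrC.
apply: L2_axpy => //; rewrite /L2/=.
rewrite (_ : phi \_ O = phi); first exact: test_function_Lfun2 tphi.
have [_ _ phiO] := tphi; apply/funext => x; rewrite patchE; case: ifPn => // /negP xO.
by apply/esym/eqP/negPn/negP => px; apply: xO; apply/mem_set/phiO/subset_closure.
Qed.

(** From [(c x + y)^2 <= 2 c^2 x^2 + 2 y^2]. The finite index set serves both a single function and
    the components of a gradient. *)
Let int_axpy_le (I : finType) (F1 F2 : I -> 'rV[R]_d -> R) (c e1 : R) :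
  (forall i, F1 i \in Lfun mu 2%:E) -> (forall i, F2 i \in Lfun mu 2%:E) ->
  (\int[mu]_x (\sum_i F1 i x ^+ 2)%:E < e1%:E)%E ->
  (\int[mu]_x (\sum_i F2 i x ^+ 2)%:E < e1%:E)%E ->
  (\int[mu]_x (\sum_i (c * F1 i x + F2 i x) ^+ 2)%:E < (2 * (c ^+ 2 + 1) * e1)%:E)%E.
Proof.
move=> F12 F22 h1 h2.
have m1 : measurable_fun setT (fun x => \sum_i F1 i x ^+ 2).
  by apply: measurable_sum => i; apply: measurable_funX; exact: Lfun2_measurable (F12 i).
have m2 : measurable_fun setT (fun x => \sum_i F2 i x ^+ 2).
  by apply: measurable_sum => i; apply: measurable_funX; exact: Lfun2_measurable (F22 i).
have p1 x : 0 <= \sum_i F1 i x ^+ 2 by apply: sumr_ge0 => i _; exact: sqr_ge0.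
have p2 x : 0 <= \sum_i F2 i x ^+ 2 by apply: sumr_ge0 => i _; exact: sqr_ge0.
apply: (@le_lt_trans _ _ (\int[mu]_x ((2 * c ^+ 2)%:E * (\sum_i F1 i x ^+ 2)%:E +
   2%:E * (\sum_i F2 i x ^+ 2)%:E))%E).
  apply: ge0_le_integral => //.
  - by move=> x _; rewrite lee_fin; apply: sumr_ge0 => i _; exact: sqr_ge0.
  - apply/measurable_EFinP; apply: measurable_sum => i; apply: measurable_funX.
    by have := Lfun2_measurable (Lfun2_axpy c (F12 i) (F22 i)).
  - apply: emeasurable_funD; apply: measurable_funeM; exact/measurable_EFinP.
  - move=> x _; rewrite -!EFinM -EFinD lee_fin !mulr_sumr -big_split ler_sum//= => i _.
    by have := sqr_ge0 (c * F1 i x - F2 i x); nra.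
rewrite ge0_integralD//; last 4 first.
- by move=> x _; rewrite mule_ge0// lee_fin// mulr_ge0// sqr_ge0.
- by apply: measurable_funeM; exact/measurable_EFinP.
- by move=> x _; rewrite mule_ge0// lee_fin.
- by apply: measurable_funeM; exact/measurable_EFinP.
rewrite !ge0_integralZl//; try exact/measurable_EFinP; try (by move=> x _; rewrite lee_fin);
  try (by rewrite lee_fin// mulr_ge0// sqr_ge0).
have : (0 <= \int[mu]_x (\sum_i F1 i x ^+ 2)%:E)%E by apply: integral_ge0 => x _; rewrite lee_fin.
have : (0 <= \int[mu]_x (\sum_i F2 i x ^+ 2)%:E)%E by apply: integral_ge0 => x _; rewrite lee_fin.
move: h1 h2; case: (\int[mu]_x (\sum_i F1 i x ^+ 2)%:E)%E => [a| |]//.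
case: (\int[mu]_x (\sum_i F2 i x ^+ 2)%:E)%E => [b| |]//.
rewrite -!EFinM -EFinD !lte_fin !lee_fin => ae be b0 a0.
have : c ^+ 2 * a <= c ^+ 2 * e1 by rewrite ler_wpM2l ?sqr_ge0// ltW.
by set C := c ^+ 2; lra.
Qed.

Lemma H10_axpy (c : R) v1 v2 : H10 O v1 -> H10 O v2 -> H10 O (fun x => c * v1 x + v2 x).
Proof.
move=> [g1 wg1 a1] [g2 wg2 a2]; exists (fun x => c *: g1 x + g2 x).
  exact: is_weak_grad_axpy.
move=> e e0.
(* Chosen so that [int_axpy_le], applied to [e1 ^+ 2], yields exactly [e ^+ 2]. *)
pose e1 := e / Num.sqrt (2 * (c ^+ 2 + 1)).
have c0 : 0 < 2 * (c ^+ 2 + 1) by rewrite mulr_gt0// ltr_wpDl// sqr_ge0.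
have e10 : 0 < e1 by rewrite divr_gt0// sqrtr_gt0.
have e1E : 2 * (c ^+ 2 + 1) * e1 ^+ 2 = e ^+ 2.
  by rewrite /e1 expr_div_n sqr_sqrtr ?(ltW c0)// mulrC divfK// gt_eqF.
have [phi1 [t1 n1 m1]] := a1 _ e10; have [phi2 [t2 n2 m2]] := a2 _ e10.
exists (fun x => c * phi1 x + phi2 x); split; first exact: test_function_axpy.
- have [v12 _ _] := wg1; have [v22 _ _] := wg2.
  apply/L2norm_ltP => //.
  move: n1 n2 => /(L2norm_ltP _ _ _ e10) n1 /(L2norm_ltP _ _ _ e10) n2.
  have E (f : 'rV[R]_d -> R) :
      (\int[mu]_x (f x ^+ 2)%:E = \int[mu]_x (\sum_(i < 1) f x ^+ 2)%:E)%E.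
    by apply: eq_integral => x _; rewrite big_ord1.
  have := @int_axpy_le 'I_1 (fun=> (v1 \- phi1) \_ O) (fun=> (v2 \- phi2) \_ O) c (e1 ^+ 2)
    (fun=> L2_sub_test v12 t1) (fun=> L2_sub_test v22 t2).
  rewrite -!E e1E => /(_ n1 n2); congr (_ < _)%E; apply: eq_integral => x _.
  congr (EFin (_ ^+ 2)).
  rewrite -[LHS]/((fun x => c * ((v1 \- phi1) \_ O) x + ((v2 \- phi2) \_ O) x) x).
  by rewrite -restrict_axpy !patchE; case: ifP => // _ /=; ring.
- have [_ g12 _] := wg1; have [_ g22 _] := wg2.
  apply/L2norm_ltP => //.
  move: m1 m2 => /(L2norm_ltP _ _ _ e10) m1 /(L2norm_ltP _ _ _ e10) m2.
  have E (f : 'rV[R]_d -> 'rV[R]_d) : (\int[mu]_x (((fun x => enorm (f x)) \_ O) x ^+ 2)%:E =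
      \int[mu]_x (\sum_i ((fun x => f x ord0 i) \_ O) x ^+ 2)%:E)%E.
    by apply: eq_integral => x _; rewrite sqr_enorm_restrict.
  rewrite E in m1; rewrite E in m2; rewrite E.
  have gt2 g phi i : L2 mu O (fun x => g x ord0 i) -> test_function O phi ->
      (fun x => (g x - grad phi x) ord0 i) \_ O \in Lfun mu 2%:E.
    move=> g2' tphi.
    rewrite (_ : (fun x => (g x - grad phi x) ord0 i) = (fun x => g x ord0 i) \- partial i phi).
      exact: L2_sub_test g2' (test_function_partial i tphi).
    by apply/funext => x; rewrite !mxE.
  have := int_axpy_le c (fun i => gt2 _ _ i (g12 i) t1) (fun i => gt2 _ _ i (g22 i) t2) m1 m2.
  rewrite e1E; congr (_ < _)%E; apply: eq_integral => x _.
  congr EFin; apply: eq_bigr => i _; congr (_ ^+ 2).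
  rewrite -[LHS]/((fun x => c * ((fun x => (g1 x - grad phi1 x) ord0 i) \_ O) x +
    ((fun x => (g2 x - grad phi2 x) ord0 i) \_ O) x) x) -restrict_axpy.
  rewrite !patchE; case: ifP => // _; rewrite !mxE.
  rewrite (_ : partial i (fun x => c * phi1 x + phi2 x) x = c * partial i phi1 x + partial i phi2 x); first by ring.
  have [C1 _ _] := t1; have [C2 _ _] := t2; have [d1 _] := C1 1; have [d2 _] := C2 1.
  exact: partial_axpy.
Qed.

Lemma H10_0 : H10 O (fun=> 0).
Proof.
exists (fun=> 0); first exact: is_weak_grad0.
move=> e e0; exists (fun=> 0); split; first exact: test_function0.
- apply/L2norm_ltP => //; rewrite (eq_integral (cst 0%E)) ?integral0 ?lte_fin ?exprn_gt0//.
  by move=> x _; rewrite patchE/= subrr; case: ifP; rewrite expr0n.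
- apply/L2norm_ltP => //; rewrite (eq_integral (cst 0%E)) ?integral0 ?lte_fin ?exprn_gt0//.
  move=> x _; rewrite sqr_enorm_restrict big1// => i _; rewrite patchE !mxE.
  by rewrite /partial derive_cst subrr; case: ifP; rewrite expr0n.
Qed.

End weak_gradients.

(** * Linear structure of [Vh] *)

Section discrete_space.
Context {R : realType} {d : nat}.
Variables (O : set 'rV[R]_d) (Th : seq 'M[R]_(d.+1, d)) (p : nat).

Lemma Vh0 : Vh O Th p (fun=> 0).
Proof.
split; first exact: H10_0.
move=> K KT; exists 0; first by rewrite mpoly.msize0.
by move=> x _ _; rewrite mpoly.meval0.
Qed.

Lemma Vh_axpy (c : R) v w : Vh O Th p v -> Vh O Th p w -> Vh O Th p (fun x => c * v x + w x).
Proof.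
move=> [v1 vT] [w1 wT]; split; first exact: H10_axpy.
move=> K KT; have [P sP PE] := vT K KT; have [Q sQ QE] := wT K KT.
exists (c *: P + Q); last by move=> x xK xO; rewrite mpoly.mevalD mpoly.mevalZ PE// QE.
rewrite (leq_trans (mpoly.msizeD_le _ _))// geq_max sQ andbT.
by rewrite (leq_trans (mpoly.msizeZ_le _ _)).
Qed.

Lemma Vh_sum I (r : seq I) (c : I -> R) (w : I -> 'rV[R]_d -> R) :
  (forall i, Vh O Th p (w i)) -> Vh O Th p (fun x => \sum_(i <- r) c i * w i x).
Proof.
move=> wV; elim: r => [|i r IH]; first by under eq_fun do rewrite big_nil; exact: Vh0.
under eq_fun do rewrite big_cons.
exact: Vh_axpy.
Qed.

End discrete_space.

(** * Time nodes and location of a time in the partition *)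

Section time_slices.
Context {R : realType} (N : nat) (t : nat -> R).
Local Notation mu := (@lebesgue_measure R).

Definition nodes : set R := [set t n | n in `I_N.+1].

Lemma finite_nodes : finite_set nodes.
Proof. exact: finite_image. Qed.

Lemma measurable_nodes : measurable (nodes : set (measurableTypeR R)).
Proof. exact: (countable_measurable (fun x => @measurable_set1 _ _) (finite_set_countable finite_nodes)). Qed.

Lemma nodes_null : mu nodes = 0%E.
Proof. by apply: countable_lebesgue_measure0; apply: finite_set_countable; exact: finite_nodes. Qed.

Lemma slab_index s : t 0 < s < t N -> ~ nodes s -> exists2 n, (n < N)%N & t n < s < t n.+1.
Proof.
rewrite /nodes; elim: N => [|k IH].
  by move=> /andP[a b]; have := lt_trans a b; rewrite ltxx.
move=> /andP[s0 s1] ns.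
have [sk|ks|sk] := ltgtP s (t k); last by case: ns; exists k => //=; rewrite -sk.
  have [||n nk sn] := IH; first by rewrite s0.
    by move=> [j /= jk js]; apply: ns; exists j => //=; rewrite ltnS ltnW.
  by exists n => //; rewrite ltnS ltnW.
by exists k => //; rewrite ks.
Qed.

Lemma closed_slab_index s : (0 < N)%N -> t 0 <= s <= t N ->
  exists2 n, (n < N)%N & t n <= s <= t n.+1.
Proof.
elim: N => // k IH _ /andP[s0 s1].
have [sk|sk] := leP (t k) s; first by exists k => //; rewrite sk.
case: k IH s1 sk => [|k] IH s1 sk; first by rewrite leNgt sk in s0.
have [//||n nk sn] := IH; first by rewrite s0 ltW.
by exists n => //; exact: ltnW.
Qed.

End time_slices.

(** * Polynomials in time with coefficients in [Vh] *)

Section discrete_polynomials.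
Context {R : realType} {d : nat}.
Variables (O : set 'rV[R]_d) (Th : seq 'M[R]_(d.+1, d)) (p : nat).
Local Notation mu := (leb d : set 'rV[R]_d -> \bar R).
Implicit Types (U : 'rV[R]_d -> {poly R}) (G : 'I_d -> 'rV[R]_d -> {poly R}).

(* [U] represents an element of [P^(m-1) (x) Vh] on one time slab, and [G] its gradient;
   both are extended by [0] outside of the domain. *)
Definition disc_rep (m : nat) U G : Prop :=
  exists w : nat -> 'rV[R]_d -> R, exists g : nat -> 'rV[R]_d -> 'rV[R]_d,
  [/\ forall k, Vh O Th p (w k),
      forall k, is_weak_grad O (w k) (g k),
      U = fun x => \poly_(k < m) (w k \_ O) x &
      G = fun i x => \poly_(k < m) ((fun x => g k x ord0 i) \_ O) x].

Lemma is_weak_grad_ext v v' g g' : (forall x, O x -> v x = v' x) ->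
  (forall x, O x -> g x = g' x) -> is_weak_grad O v g -> is_weak_grad O v' g'.
Proof.
move=> vE gE [v2 g2 vg].
have ext (h h' : 'rV[R]_d -> R) : (forall x, O x -> h x = h' x) -> h \_ O = h' \_ O.
  by move=> hE; apply/funext => x; rewrite !patchE; case: ifPn => // /set_mem; exact: hE.
split=> [|i|phi tphi i].
- by rewrite /L2/= -(ext _ _ vE).
- rewrite /L2/= -(ext (fun x => g x ord0 i)); first exact: g2.
  by move=> x Ox; rewrite gE.
- rewrite !L2ipEl -(ext _ _ vE) -(ext (fun x => g x ord0 i) (fun x => g' x ord0 i)).
    by rewrite -!L2ipEl vg.
  by move=> x Ox; rewrite gE.
Qed.

Lemma Vh_weak_grad v : Vh O Th p v -> exists g, is_weak_grad O v g.
Proof. by case=> -[g wg _] _; exists g. Qed.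

Lemma disc_rep_exists m (w : nat -> 'rV[R]_d -> R) : (forall k, Vh O Th p (w k)) ->
  exists G, disc_rep m (fun x => \poly_(k < m) (w k \_ O) x) G.
Proof.
move=> wV; have /choice[g gP] k : exists g, is_weak_grad O (w k) g by exact: Vh_weak_grad.
by exists (fun i x => \poly_(k < m) ((fun x => g k x ord0 i) \_ O) x); exists w, g.
Qed.

Lemma disc_rep_L2poly m U G : disc_rep m U G ->
  L2poly (leb d) m U /\ forall i, L2poly (leb d) m (G i).
Proof.
move=> [w [g [wV gP -> ->]]].
have H (h : nat -> 'rV[R]_d -> R) : (forall k, L2 mu O (h k)) ->
    L2poly (leb d) m (fun x => \poly_(k < m) (h k \_ O) x).
  move=> h2; split=> [x|k]; first exact: size_poly.
  under eq_fun do rewrite coef_poly.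
  by case: ltnP => _; [exact: h2|exact: Lfun2_0].
split=> [|i]; first by apply: H => k; have [] := gP k.
by apply: (H (fun k x => g k x ord0 i)) => k; have [_ + _] := gP k; apply.
Qed.

Lemma disc_rep_out m U G : disc_rep m U G ->
  (forall x, ~ O x -> U x = 0) /\ (forall i x, ~ O x -> G i x = 0).
Proof.
move=> [w [g [wV gP -> ->]]]; split=> [x xO|i x xO]; apply/polyP => k;
  by rewrite coef_poly coef0 patchE memNset//; case: ifP.
Qed.

Let sum_polyXn m (M : {linear {poly R} -> {poly R}}) (c : nat -> R) j :
  (M (\poly_(k < m) c k))`_j = \sum_(k < m) (M 'X^k)`_j * c k.
Proof.
rewrite poly_def linear_sum coef_sum; apply: eq_bigr => k _.
by rewrite linearZ coefZ mulrC.
Qed.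

(** An operator in time mixes the coefficients with weights constant in space, so it stays in [Vh]
    and commutes with the gradient. This is what makes operators in time applied to [u] legal
    tests. *)
Lemma disc_rep_linear m m' (M : {linear {poly R} -> {poly R}}) U G :
  (forall r : {poly R}, (size r <= m)%N -> (size (M r) <= m')%N) ->
  disc_rep m U G -> disc_rep m' (M \o U) (fun i => M \o G i).
Proof.
move=> sM [w [g [wV gP -> ->]]].
exists (fun j x => \sum_(k < m) (M 'X^k)`_j * w k x).
exists (fun j x => \sum_(k < m) (M 'X^k)`_j *: g k x).
have sE (h : nat -> R) : M (\poly_(k < m) h k) = \poly_(j < m') (\sum_(k < m) (M 'X^k)`_j * h k).
  apply/polyP => j; rewrite coef_poly -sum_polyXn; case: ltnP => // mj.
  by rewrite nth_default// (leq_trans _ mj)// sM// size_poly.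
split.
- by move=> k; exact: Vh_sum.
- by move=> k; exact: is_weak_grad_sum.
- apply/funext => x /=; rewrite sE; apply: eq_poly => j _; rewrite patchE.
  case: ifPn => xO; first by apply: eq_bigr => k _; rewrite patchE xO.
  by rewrite big1// => k _; rewrite patchE (negbTE xO) mulr0.
- apply/funext => i; apply/funext => x /=; rewrite sE; apply: eq_poly => j _; rewrite patchE.
  case: ifPn => xO; last by rewrite big1// => k _; rewrite patchE (negbTE xO) mulr0.
  by rewrite summxE; apply: eq_bigr => k _; rewrite patchE xO mxE.
Qed.

Lemma disc_rep_horner m U G s : disc_rep m U G ->
  is_weak_grad O (fun x => (U x).[s]) (fun x => \row_i (G i x).[s]).
Proof.
move=> rUG; have [w [g [wV gP UE GE]]] := rUG.
have E1 x : O x -> (U x).[s] = \sum_(k < m) s ^+ k * w k x.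
  move=> /mem_set xO; rewrite UE horner_poly; apply: eq_bigr => k _.
  by rewrite patchE xO mulrC.
have E2 i x : O x -> (G i x).[s] = (\sum_(k < m) s ^+ k *: g k x) ord0 i.
  move=> /mem_set xO; rewrite GE horner_poly summxE; apply: eq_bigr => k _.
  by rewrite patchE xO mulrC mxE.
apply: is_weak_grad_ext (is_weak_grad_sum (index_enum 'I_m) (fun k : 'I_m => s ^+ k)
  (fun k : 'I_m => gP k)) => x Ox; first by rewrite E1.
by apply/rowP => i; rewrite mxE E2.
Qed.

End discrete_polynomials.

(** * Space-time uniqueness of the spatial gradient *)

Section spatial_gradients.
Context {R : realType} {d : nat}.
Variables (O : set 'rV[R]_d) (T : R).
Local Notation XT := ('rV[R]_d * measurableTypeR R)%type.
Local Notation Q := (QT O T : set XT).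
Local Notation mu := (leb_xt d : set XT -> \bar R).
Hypothesis oO : open O.
Implicit Types (u v : XT -> R) (G : XT -> 'rV[R]_d).

(** The set [E] where the two gradients differ is measurable, their components being in L^2. By
    Tonelli its measure integrates over time the measures of its slices, and [weak_grad_unique]
    makes almost every slice null. *)
Lemma xgrad_unique u G1 G2 : is_xgrad O T u G1 -> is_xgrad O T u G2 ->
  {ae mu, forall z, Q z -> G1 z = G2 z}.
Proof.
move=> [G12 w1] [G22 w2].
pose h i z : R := ((fun z => G1 z ord0 i) \_ Q) z - ((fun z => G2 z ord0 i) \_ Q) z.
have mh i : measurable_fun setT (h i).
  apply: measurable_funB; first by have := Lfun2_measurable (G12 i).
  by have := Lfun2_measurable (G22 i).
pose E : set XT := \bigcup_(i in [set: 'I_d]) (h i @^-1` (~` [set 0])).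
have mE : measurable E.
  apply: fin_bigcup_measurable => // i _; rewrite -[X in measurable X]setTI.
  by apply: mh => //; exact: measurableC.
exists E; split => //; last first.
  move=> z /= zE; apply: contrapT => Ez; apply: zE => Qz; apply/rowP => i.
  apply/eqP; rewrite -subr_eq0; apply/eqP; apply: contrapT => hz; apply: Ez.
  by exists i => //=; rewrite /h !patchE mem_set.
have fE0 : (\int[mu]_z (\1_E z)%:E)%E = 0%E.
  rewrite (fubini_tonelli2 (EFin \o \1_E)) //; last 2 first.
  - by apply/measurable_EFinP; exact: measurable_indic.
  - by move=> z; rewrite /= lee_fin.
  have [N [mN N0 HN]] : {ae lebesgue_measure, forall t : R, (0 < t < T -> is_weak_grad O (fun x => u (x, t)) (fun x => G1 (x, t)))
      /\ (0 < t < T -> is_weak_grad O (fun x => u (x, t)) (fun x => G2 (x, t)))}.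
    have FF := ae_filter_ringOfSetsType (@lebesgue_measure R).
    by apply: (@filterS2 _ _ FF _ _ _ _ w1 w2) => t a1 a2; split.
  rewrite (@integral_null_set _ _ _ _ _ (cst 0%E) N)//; first by rewrite integral0.
  move=> t Nt; rewrite /fubini_G.
  have [a1 a2] : (0 < t < T -> is_weak_grad O (fun x => u (x, t)) (fun x => G1 (x, t)))
      /\ (0 < t < T -> is_weak_grad O (fun x => u (x, t)) (fun x => G2 (x, t))).
    by apply: contrapT => H; apply: Nt; exact: HN.
  case: (boolP (0 < t < T)) => tT; last first.
    rewrite (eq_integral (cst 0%E)) ?integral0// => x _ /=.
    rewrite indicE memNset// => -[i _]; apply; rewrite /h !patchE.
    rewrite memNset ?subrr// => -[/= _]; rewrite in_itv/=; exact/negP.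
  have [A [mA A0 HA]] := weak_grad_unique oO (a1 tT) (a2 tT).
  rewrite (@integral_null_set _ _ _ _ _ (cst 0%E) A)//; first by rewrite integral0.
  move=> x Ax /=; rewrite indicE memNset// => -[i _]; apply; rewrite /h !patchE.
  case: ifPn => [/set_mem[/= Ox _]|]; last by rewrite subrr.
  have -> : G1 (x, t) = G2 (x, t); last by rewrite subrr.
  by apply: contrapT => H; apply: Ax; apply: HA => /= /(_ Ox).
by rewrite integral_indic// setIT in fE0.
Qed.

(** Since [xgrad] is an arbitrary choice, this is what allows inner products and norms to be
    computed with a coefficientwise gradient. *)
Lemma xgrad_ae u G : is_xgrad O T u G -> {ae mu, forall z, Q z -> xgrad O T u z = G z}.
Proof.
move=> uG; apply: xgrad_unique (uG).
by apply: (@xgetPex _ (fun=> 0) [set G | is_xgrad O T u G]); exists G.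
Qed.

Lemma xgrad_ipE u v G H : is_xgrad O T u G -> is_xgrad O T v H ->
  xgrad_ip O T u v =
  \sum_i \int[mu]_z (((fun z => G z ord0 i) \_ Q) z * ((fun z => H z ord0 i) \_ Q) z).
Proof.
move=> uG vH; have [N [mN N0 HN]] := filterI (xgrad_ae uG) (xgrad_ae vH).
rewrite /xgrad_ip (@Rintegral_null_set _ _ _ _ _ _ (fun z => dot (G z) (H z)) N)//; last first.
  move=> z Qz Nz; have [->//] : xgrad O T u z = G z /\ xgrad O T v z = H z.
    apply: contrapT => h; apply: Nz; apply: HN => -[/(_ Qz) h1 /(_ Qz) h2].
    by apply: h.
  by move=> ->.
rewrite Rintegral_mkcond.
have [G2 _] := uG; have [H2 _] := vH.
rewrite -(Rintegral_sum _ _).2; last by move=> i _; exact: (Lfun2_mul_integrable (G2 i) (H2 i)).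
apply: eq_Rintegral => z _; rewrite !patchE; case: ifPn => zQ.
  by apply: eq_bigr => i _; rewrite !patchE zQ.
by rewrite big1// => i _; rewrite !patchE (negbTE zQ) mul0r.
Qed.

Lemma xgrad_norm_sqrE u G : is_xgrad O T u G ->
  (xgrad_norm O T u ^+ 2 = (\sum_i \int[mu]_z (((fun z => G z ord0 i) \_ Q) z ^+ 2))%:E)%E.
Proof.
move=> uG; have [N [mN N0 HN]] := xgrad_ae uG; have [G2 _] := uG.
rewrite /xgrad_norm L2norm_sqr.
have [i2 <-] := Rintegral_sum (index_enum 'I_d) (fun i (_ : xpredT i) => Lfun2_integrable_sqr (G2 i)).
rewrite /Rintegral fineK; last exact: integrable_fin_num.
apply: (integral_null_set mN N0) => z Nz; congr EFin; rewrite patchE; case: ifPn => zQ.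
  rewrite sqr_enorm (_ : xgrad O T u z = G z).
    by apply: eq_bigr => i _; rewrite patchE zQ.
  by apply: contrapT => h; apply: Nz; apply: HN => /(_ (set_mem zQ)).
by rewrite expr0n big1// => i _; rewrite patchE (negbTE zQ) expr0n.
Qed.

End spatial_gradients.

(** * Representing discrete functions by slab polynomials *)

Section space_time_polynomials.
Context {R : realType} {d : nat}.
Variables (O : set 'rV[R]_d) (T : R) (Th : seq 'M[R]_(d.+1, d)) (p N : nat) (t : nat -> R).
Local Notation XT := ('rV[R]_d * measurableTypeR R)%type.
Local Notation Q := (QT O T : set XT).
Local Notation mu := (leb_xt d : set XT -> \bar R).
Local Notation slabsN := (slabs N t).
Hypothesis tp : time_partition T N t.
Implicit Types (u v : XT -> R) (U V : nat -> 'rV[R]_d -> {poly R})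
  (G : nat -> 'I_d -> 'rV[R]_d -> {poly R}).

Definition agrees u U : Prop := forall n x s, (n < N)%N -> O x -> t n < s < t n.+1 ->
  u (x, s) = (U n x).[s].

Definition disc_reps m U G : Prop := forall n, (n < N)%N -> disc_rep O Th p m (U n) (G n).

Let tlt n : (n < N)%N -> t n < t n.+1. Proof. by have [_ _] := tp; apply. Qed.

Lemma slab_sub n s : (n < N)%N -> t n < s < t n.+1 -> 0 < s < T.
Proof.
move=> nN /andP[s1 s2]; have [<- <- _] := tp; apply/andP; split.
  by apply: le_lt_trans s1; apply: (partition_le tlt); rewrite leq0n ltnW.
by apply: (lt_le_trans s2); apply: (partition_le tlt); rewrite nN leqnn.
Qed.

Lemma slabs_out U z : (forall n x, (n < N)%N -> ~ O x -> U n x = 0) -> ~ Q z -> slabsN U z = 0.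
Proof.
case: z => x s UO Qz; rewrite /slabs big1// => n _; rewrite /slab patchE.
case: ifPn => // /set_mem/=; rewrite in_itv/= => sn.
have [Ox|/UO ->//] := pselect (O x); last by rewrite horner0.
by case: Qz; split => //=; rewrite in_itv/=; exact: slab_sub sn.
Qed.

Lemma slabs_restrict U : (forall n x, (n < N)%N -> ~ O x -> U n x = 0) -> slabsN U \_ Q = slabsN U.
Proof.
move=> UO; apply/funext => z; rewrite patchE; case: ifPn => // /negP zQ.
by rewrite slabs_out// => /mem_set.
Qed.

Lemma disc_reps_out m U G : disc_reps m U G ->
  (forall n x, (n < N)%N -> ~ O x -> U n x = 0) /\
  (forall i n x, (n < N)%N -> ~ O x -> G n i x = 0).
Proof.
move=> r; split=> [n x nN xO|i n x nN xO]; have [h1 h2] := disc_rep_out (r n nN).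
  exact: h1.
exact: h2.
Qed.

Lemma slabs_agrees U : agrees (slabsN U) U.
Proof. by move=> n x s nN Ox sn; rewrite (slabsE tlt _ _ nN sn). Qed.

Lemma measurable_nodes_xt : measurable ([set: 'rV[R]_d] `*` nodes N t : set XT).
Proof. by apply: measurableX => //; exact: measurable_nodes. Qed.

Lemma nodes_xt_null : mu ([set: 'rV[R]_d] `*` nodes N t : set XT) = 0%E.
Proof.
rewrite product_measure1E//; last exact: measurable_nodes.
by rewrite [X in (_ * X)%E](nodes_null N t) mule0.
Qed.

Lemma agrees_slabs u U z : agrees u U -> Q z -> ~ ([set: 'rV[R]_d] `*` nodes N t) z ->
  u z = slabsN U z.
Proof.
case: z => x s uU [/= Ox]; rewrite in_itv/= => sT nz.
have [n nN sn] : exists2 n, (n < N)%N & t n < s < t n.+1.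
  apply: slab_index; first by have [-> -> _] := tp.
  by move=> ns; apply: nz.
by rewrite (uU n)// (slabsE tlt _ _ nN sn).
Qed.

(** Serves for [dt u], whose values at the nodes are uncontrolled: the null set of nodes is
    discarded without asking for measurability of [u]. *)
Lemma L2ip_agrees u U V : agrees u U -> (forall n x, (n < N)%N -> ~ O x -> V n x = 0) ->
  L2ip mu Q u (slabsN V) = \int[mu]_z (slabsN U z * slabsN V z).
Proof.
move=> uU V0.
rewrite /L2ip (Rintegral_null_set (g := fun z => slabsN U z * slabsN V z)
  measurable_nodes_xt nodes_xt_null); last first.
  by move=> z Qz nz; rewrite (agrees_slabs uU).
rewrite Rintegral_mkcond; apply: eq_Rintegral => z _; rewrite patchE.
case: ifPn => // /negP zQ; rewrite [slabsN V z]slabs_out ?mulr0//.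
by move=> /mem_set.
Qed.

Lemma is_xgrad_agrees m u U G : disc_reps m U G -> agrees u U ->
  is_xgrad O T u (fun z => \row_i slabsN (fun n => G n i) z).
Proof.
move=> r uU; have [U0 G0] := disc_reps_out r.
split=> [i|].
  under eq_fun do rewrite mxE.
  rewrite /L2/= slabs_restrict; last exact: G0.
  by apply: (@slabs_Lfun2 _ _ _ _ _ _ m) => n nN; have [_] := disc_rep_L2poly (r n nN).
exists (nodes N t); split.
- exact: measurable_nodes.
- exact: nodes_null.
move=> s /=; apply: contra_notP => ns sT.
have [n nN sn] : exists2 n, (n < N)%N & t n < s < t n.+1.
  by apply: slab_index => //; have [-> -> _] := tp.
apply: is_weak_grad_ext (disc_rep_horner s (r n nN)) => x Ox; first by rewrite (uU n).
by apply/rowP => i; rewrite !mxE (slabsE tlt _ _ nN sn).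
Qed.

Lemma Vdisc_rep m u : Vdisc O T N t (Vh O Th p) m u ->
  exists U, exists G, disc_reps m.+1 U G /\ agrees u U.
Proof.
move=> [_ uV].
have /choice[w wP] n : exists w : nat -> 'rV[R]_d -> R, (n < N)%N -> (forall k, Vh O Th p (w k)) /\
    forall x s, O x -> t n < s < t n.+1 -> u (x, s) = \sum_(k < m.+1) s ^+ k * w k x.
  (* A dummy value beyond the last slab lets [choice] range over all [n]. *)
  case: (boolP (n < N)%N) => nN; last by exists (fun _ _ => 0).
  by have [w wV wE] := uV n nN; exists w.
have /choice[G GP] n : exists G : 'I_d -> 'rV[R]_d -> {poly R}, (n < N)%N ->
    disc_rep O Th p m.+1 (fun x => \poly_(k < m.+1) (w n k \_ O) x) G.
  case: (boolP (n < N)%N) => nN; last by exists (fun _ _ => 0).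
  by have [wV _] := wP n nN; have [G GP] := disc_rep_exists m.+1 wV; exists G.
exists (fun n x => \poly_(k < m.+1) (w n k \_ O) x), G; split => //.
move=> n x s nN Ox sn; have [_ ->//] := wP n nN.
by rewrite horner_poly; apply: eq_bigr => k _; rewrite patchE mem_set// mulrC.
Qed.

Lemma slabs_Vdisc m U G : disc_reps m.+1 U G -> Vdisc O T N t (Vh O Th p) m (slabsN U).
Proof.
move=> r; split.
  apply: (@measurable_funS _ _ _ _ setT) => //.
  apply: (@Lfun2_measurable _ _ _ mu); apply: (@slabs_Lfun2 _ _ _ _ _ _ m.+1) => n nN.
  by have [] := disc_rep_L2poly (r n nN).
move=> n nN; have [w [g [wV _ UE _]]] := r n nN; exists w => // x s Ox sn.
rewrite (slabsE tlt _ _ nN sn)// UE horner_poly; apply: eq_bigr => k _.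
by rewrite patchE mem_set// mulrC.
Qed.

Lemma dt_agrees u U : agrees u U -> agrees (dt u) (fun n x => (U n x)^`()).
Proof.
move=> uU n x s nN Ox sn; rewrite /dt/= derive1E.
have [_ <-] := is_derive_poly (U n x) s.
apply: near_eq_derive.
have : nbhs s (`]t n, t n.+1[%classic : set R).
  by apply: open_nbhs_nbhs; split; [exact: interval_open|rewrite /= in_itv].
by apply: filterS => y; rewrite /= in_itv/= => yn; rewrite (uU n).
Qed.

(** [poly_proj] is selected by [xget]; uniqueness identifies it with [pproj], whose own properties
    show that there is something to select. *)
Lemma poly_proj_horner (a b : R) m (r : {poly R}) (g : R -> R) : a < b ->
  (forall s, a < s < b -> g s = r.[s]) -> poly_proj a b m g = pproj a b m.+1 r.
Proof.
move=> ab gE.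
have ipE (f : R -> R) (P S : {poly R}) : (forall s, a < s < b -> f s = P.[s]) ->
    L2ip (@lebesgue_measure R) `]a, b[ f (horner S) = pint a b (P * S).
  move=> fE; apply: eq_Rintegral => s; rewrite inE/= in_itv/= => sab.
  by rewrite fE// hornerM.
rewrite /poly_proj; case: xgetP => [P _ [sP PP]|].
  apply: pproj_unique => // S sS; have := PP _ sS.
  by rewrite (ipE _ P)// (ipE _ r).
move=> /(_ (pproj a b m.+1 r)) []; split; first exact: size_pproj.
move=> S sS; rewrite (ipE _ (pproj a b m.+1 r))// (ipE _ r)//.
exact: pprojP.
Qed.

Lemma time_proj_agrees m u U : agrees u U ->
  agrees (time_proj N t m u) (fun n x => pproj (t n) (t n.+1) m.+1 (U n x)).
Proof.
move=> uU n x s nN Ox sn; rewrite /time_proj/= (bigD1 (Ordinal nN))//= big1.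
  rewrite addr0 (@poly_proj_horner _ _ _ (U n x))//; first exact: tlt.
  by move=> y yn; exact: uU.
move=> j /andP[sj /eqP jn]; case: jn; apply/val_inj; exact: (partition_uniq tlt) sj sn.
Qed.

End space_time_polynomials.

(** * Pairing L^1 in time with a bound uniform in time *)

Section L1L2_duality.
Context {R : realType} {d : nat}.
Variables (O : set 'rV[R]_d) (T : R).
Local Notation XT := ('rV[R]_d * measurableTypeR R)%type.
Local Notation Q := (QT O T : set XT).
Local Notation mu := (leb_xt d : set XT -> \bar R).
Local Notation lam := (@lebesgue_measure R).
Implicit Types f v : XT -> R.

Lemma measurable_Lnorm2_section f : measurable_fun setT f ->
  measurable_fun [set: measurableTypeR R]
    (fun s => 'N[leb d]_2%:E[EFin \o (fun x => f (x, s))])%E.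
Proof.
move=> mf; rewrite unlock; apply: (measurableT_comp (measurable_poweR _)).
apply: (measurable_fun_fubini_tonelli_G (fun z : XT => (`|(f z)%:E| `^ 2)%E)) => [|z].
  apply: (measurableT_comp (measurable_poweR _)).
  by apply: measurableT_comp => //; exact/measurable_EFinP.
exact: poweR_ge0.
Qed.

Lemma norm_L1L2E f :
  (norm_L1L2 O T f = \int[lam]_s 'N[leb d]_2%:E[EFin \o (fun x => (f \_ Q) (x, s))])%E.
Proof.
rewrite /norm_L1L2 integral_mkcond; apply: eq_integral => s _; rewrite patchE.
case: ifPn => [/set_mem sT|/negP sT].
  rewrite /L2norm; congr (Lnorm _ _ (EFin \o _)); apply/funext => x; rewrite !patchE.
  by have [xO|xO] := boolP (x \in O); [rewrite mem_set//; split => //; exact: set_mem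
    |rewrite memNset// => -[/= Ox _]; move: xO; rewrite mem_set].
have -> : EFin \o (fun x => (f \_ Q) (x, s)) = cst 0%E.
  by apply/funext => x /=; rewrite patchE memNset// => -[_ /= /mem_set].
by rewrite Lnorm0.
Qed.

(** After Tonelli, Hoelder in space at each time, then the uniform bound [b] is taken out of the
    time integral. *)
Lemma L2ip_le_L1L2 f v (b : R) : 0 <= b -> L2 mu Q f -> v \in Lfun mu 2%:E ->
  (forall s, 'N[leb d]_2%:E[EFin \o (fun x => v (x, s))] <= b%:E)%E ->
  ((L2ip mu Q f v)%:E <= b%:E * norm_L1L2 O T f)%E.
Proof.
move=> b0 f2 v2 vb.
have mf := Lfun2_measurable f2; have mv := Lfun2_measurable v2.
have ifv := Lfun2_mul_integrable f2 v2.
have mh : measurable_fun setT (fun z : XT => ((f \_ Q) z * v z)%:E) by exact: measurable_int ifv.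
rewrite L2ipEl /Rintegral fineK; last exact: integrable_fin_num.
apply: (le_trans (lee_abs _)); apply: (le_trans (le_abse_integral _ measurableT mh)).
rewrite (fubini_tonelli2 (fun z : XT => `|((f \_ Q) z * v z)%:E|%E)) //; last first.
  exact: measurableT_comp.
have mN := measurable_Lnorm2_section mf.
rewrite norm_L1L2E -ge0_integralZl//; last by move=> s _; exact: Lnorm_ge0.
apply: ge0_le_integral => //.
- by move=> s _; apply: integral_ge0.
- apply: (measurable_fun_fubini_tonelli_G (fun z : XT => `|((f \_ Q) z * v z)%:E|%E)) => //.
  exact: measurableT_comp.
- exact: measurable_funeM.
move=> s _; rewrite /fubini_G -(Lnorm1 (leb d) (EFin \o ((fun x => (f \_ Q) (x, s)) \* (fun x => v (x, s))))).
apply: (le_trans (@hoelder _ _ _ (leb d) _ _ 2 2 _ _ _ _ _)) => //.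
- exact: (measurableT_comp mf (pair2_measurable _)).
- exact: (measurableT_comp mv (pair2_measurable _)).
- by field.
by rewrite muleC; apply: lee_wpmul2r => //; exact: Lnorm_ge0.
Qed.

End L1L2_duality.

(** * The energy estimate; here [q] is the degree in time of the test functions, one below that of
    [u] *)

Section energy.
Context {R : realType} {d : nat}.
Variables (O : set 'rV[R]_d) (T : R) (Th : seq 'M[R]_(d.+1, d)) (p N : nat) (t : nat -> R).
Variables (q : nat) (nu F : R) (f Ups u : 'rV[R]_d * measurableTypeR R -> R).
Variables (Y : 'rV[R]_d * measurableTypeR R -> 'rV[R]_d).
Variables (U : nat -> 'rV[R]_d -> {poly R}) (G : nat -> 'I_d -> 'rV[R]_d -> {poly R}).
Local Notation XT := ('rV[R]_d * measurableTypeR R)%type.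
Local Notation Q := (QT O T : set XT).
Local Notation mu := (leb_xt d : set XT -> \bar R).
Local Notation slabsN := (slabs N t).
Local Notation ip n A B := (\int[leb d]_x pint (t n) (t n.+1) (A x * B x)).
Local Notation Pi n := (pproj (t n) (t n.+1) q.+1).
Local Notation PB n := (wproj (t n) (t n.+1) q.+1).
Hypotheses (oO : open O) (tp : time_partition T N t) (nu0 : 0 < nu).
Hypotheses (f2 : L2 mu Q f) (FE : norm_L1L2 O T f = F%:E) (UpsY : is_xgrad O T Ups Y).
Hypotheses (UG : disc_reps O Th p N q.+2 U G) (uU : agrees O N t u U).
Hypothesis scheme : forall v, Vdisc O T N t (Vh O Th p) q v ->
  L2ip mu Q (dt u) v + nu * xgrad_ip O T u v = L2ip mu Q f v + nu * xgrad_ip O T Ups v.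

Let tlt n : (n < N)%N -> t n < t n.+1. Proof. by have [_ _] := tp; apply. Qed.

(** Already squared, despite its name. *)
Definition Ynorm : R := \sum_i \int[mu]_z (((fun z => Y z ord0 i) \_ Q) z ^+ 2).

Lemma slabs_section_norm m V (b : R) : (forall n, (n < N)%N -> L2poly (leb d) m (V n)) ->
  0 <= b -> (forall n s, (n < N)%N -> t n < s < t n.+1 -> \int[leb d]_x ((V n x).[s] ^+ 2) <= b ^+ 2) ->
  forall s, ('N[leb d]_2%:E[EFin \o (fun x => slabsN V (x, s))] <= b%:E)%E.
Proof.
move=> V2 b0 Vb s.
have [[n [nN sn]]|ns] := pselect (exists n, (n < N)%N /\ t n < s < t n.+1).
  under eq_fun do rewrite (slabsE tlt V _ nN sn).
  rewrite (Lfun2_Lnorm (L2poly_horner s (V2 n nN))) lee_fin.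
  by rewrite -(ger0_norm b0) -sqrtr_sqr ler_wsqrtr// Vb.
rewrite (_ : EFin \o _ = cst 0%E) ?Lnorm0//; apply/funext => x /=.
rewrite /slabs big1// => n _; rewrite /slab patchE memNset//= in_itv/= => sn.
by apply: ns; exists n.
Qed.

Lemma row_slabs (H : nat -> 'I_d -> 'rV[R]_d -> {poly R}) i :
  (forall n x, (n < N)%N -> ~ O x -> H n i x = 0) ->
  (fun z => (\row_j slabsN (fun n => H n j) z) ord0 i) \_ Q = slabsN (fun n => H n i).
Proof.
move=> H0; have -> : (fun z : XT => (\row_j slabsN (fun n => H n j) z) ord0 i) = slabsN (fun n => H n i).
  by apply/funext => z; rewrite mxE.
exact: (slabs_restrict tp).
Qed.

Let U2 n : (n < N)%N -> L2poly (leb d) q.+2 (U n).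
Proof. by move=> nN; exact: (disc_rep_L2poly (UG nN)).1. Qed.

Let G2 i n : (n < N)%N -> L2poly (leb d) q.+2 (G n i).
Proof. by move=> nN; exact: (disc_rep_L2poly (UG nN)).2. Qed.

Let dU2 n : (n < N)%N -> L2poly (leb d) q.+2 (fun x => (U n x)^`()).
Proof.
move=> nN; apply: (@L2poly_linear _ _ _ _ _ _ (@deriv R) _ (U2 nN)) => r sr.
have [->|r0] := eqVneq r 0; first by rewrite linear0 size_poly0.
by rewrite (leq_trans (ltnW (lt_size_deriv r0))).
Qed.

(** The scheme is tested with [M] applied to [u] slab by slab. Only the data are estimated: [f] by
    duality against the bound [b] at each time, [Upsilon] by Young's inequality. *)
Lemma tested_scheme_le (M : nat -> {linear {poly R} -> {poly R}}) (b : R) : 0 <= b ->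
  (forall n r, (n < N)%N -> (size (r : {poly R}) <= q.+2)%N -> (size (M n r) <= q.+1)%N) ->
  (forall n s, (n < N)%N -> t n < s < t n.+1 -> \int[leb d]_x ((M n (U n x)).[s] ^+ 2) <= b ^+ 2) ->
  \sum_(n < N) ip n (fun x => (U n x)^`()) (M n \o U n) +
    nu * \sum_i \sum_(n < N) ip n (G n i) (M n \o G n i) <=
  b * F + nu * ((Ynorm + \sum_i \sum_(n < N) ip n (M n \o G n i) (M n \o G n i)) / 2).
Proof.
move=> b0 sM Mb.
pose V n := M n \o U n; pose H n i := M n \o G n i.
have VH : disc_reps O Th p N q.+1 V H.
  by move=> n nN; apply: disc_rep_linear (UG nN) => r; exact: sM.
have [V0 H0] := disc_reps_out VH; have [U0 G0] := disc_reps_out UG.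
have V2 n nN := (disc_rep_L2poly (VH n nN)).1.
have H2 i n nN := (disc_rep_L2poly (VH n nN)).2 i.
have vH := is_xgrad_agrees tp VH (slabs_agrees tp V).
have uG := is_xgrad_agrees tp UG uU.
have e1 : L2ip mu Q (dt u) (slabsN V) = \sum_(n < N) ip n (fun x => (U n x)^`()) (M n \o U n).
  by rewrite -(Rintegral_slabs_mul tlt dU2 V2); exact: (L2ip_agrees tp (dt_agrees uU) V0).
have e2 : xgrad_ip O T u (slabsN V) = \sum_i \sum_(n < N) ip n (G n i) (M n \o G n i).
  rewrite (xgrad_ipE oO uG vH); apply: eq_bigr => i _.
  rewrite (row_slabs (G0 i)) (row_slabs (H0 i)).
  exact: (Rintegral_slabs_mul tlt (G2 i) (H2 i)).
have e3 : xgrad_ip O T Ups (slabsN V) <=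
    (Ynorm + \sum_i \sum_(n < N) ip n (M n \o G n i) (M n \o G n i)) / 2.
  rewrite (xgrad_ipE oO UpsY vH) /Ynorm -big_split mulr_suml ler_sum// => i _ /=.
  rewrite (row_slabs (H0 i)) -(Rintegral_slabs_mul tlt (H2 i) (H2 i)).
  have [Y2 _] := UpsY.
  under [in X in _ <= (_ + X) / 2]eq_Rintegral do rewrite -expr2.
  apply: Rintegral_mul_le; first exact: Y2.
  by apply: (@slabs_Lfun2 _ _ _ _ _ _ q.+1) => n nN; exact: H2.
have e4 : L2ip mu Q f (slabsN V) <= b * F.
  rewrite -lee_fin EFinM -FE; apply: L2ip_le_L1L2 => //.
    by apply: (@slabs_Lfun2 _ _ _ _ _ _ q.+1).
  exact: slabs_section_norm V2 b0 Mb.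
have := lerD e4 (ler_wpM2l (ltW nu0) e3).
move: (scheme (slabs_Vdisc tp VH)).
by rewrite e1 e2 => ->.
Qed.

Let ip_integrable m m' n A B : L2poly (leb d) m A -> L2poly (leb d) m' B ->
  (leb d).-integrable setT (fun x => (pint (t n) (t n.+1) (A x * B x))%:E).
Proof. by move=> A2 B2; exact: (Rintegral_slab_mul (t n) (t n.+1) A2 B2).1. Qed.

Let ip_le m1 m2 m3 m4 n A B C D : L2poly (leb d) m1 A -> L2poly (leb d) m2 B ->
  L2poly (leb d) m3 C -> L2poly (leb d) m4 D ->
  (forall x, pint (t n) (t n.+1) (A x * B x) <= pint (t n) (t n.+1) (C x * D x)) ->
  ip n A B <= ip n C D.
Proof.
move=> A2 B2 C2 D2 h; apply: le_Rintegral => //.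
- exact: ip_integrable A2 B2.
- exact: ip_integrable C2 D2.
Qed.

Definition slab_mean n : R := ip n (U n) (U n) / (t n.+1 - t n).

Variable K : R.
Hypothesis K0 : 0 < K.
Hypothesis KP : forall (a b : R) (r : {poly R}) s, a < b -> (size r <= q.+2)%N ->
  a <= s <= b -> (b - a) * r.[s] ^+ 2 <= K * pint a b (r * r).

Lemma slab_value_le (M : {linear {poly R} -> {poly R}}) n s : (n < N)%N ->
  t n <= s <= t n.+1 ->
  (forall r : {poly R}, (size r <= q.+2)%N -> (size (M r) <= q.+2)%N) ->
  (forall r : {poly R}, pint (t n) (t n.+1) (M r * M r) <= pint (t n) (t n.+1) (r * r)) ->
  \int[leb d]_x ((M (U n x)).[s] ^+ 2) <= K * slab_mean n.
Proof.
move=> nN sn sM cM.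
have tau0 : 0 < t n.+1 - t n by rewrite subr_gt0 tlt.
have MU2 : L2poly (leb d) q.+2 (M \o U n) by exact: L2poly_linear (U2 nN) sM.
rewrite /slab_mean mulrA ler_pdivlMr// mulrC.
have iM := Lfun2_integrable_sqr (L2poly_horner s MU2).
have iUU := ip_integrable n (U2 nN) (U2 nN).
have -> : (t n.+1 - t n) * \int[leb d]_x ((M (U n x)).[s] ^+ 2) =
    \int[leb d]_x ((t n.+1 - t n) * (M (U n x)).[s] ^+ 2) by rewrite -RintegralZl.
rewrite -RintegralZl//; apply: le_Rintegral => //.
- exact: (integrableZl measurableT _ iM).
- exact: (integrableZl measurableT _ iUU).
move=> x _; apply: (le_trans (KP _ _ _)) => //.
- exact: tlt.
- by apply: sM; have [+ _] := U2 nN; apply.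
- by rewrite ler_pM2l.
Qed.

(** In order, the clauses make [M u] a legal test, bound it at each time through [slab_value_le],
    and let the diffusion absorb half of the squared gradient left by Young's inequality. *)
Definition admissible (M : nat -> {linear {poly R} -> {poly R}}) : Prop :=
  forall n (r : {poly R}), (n < N)%N ->
  [/\ (size (M n r) <= q.+1)%N,
      pint (t n) (t n.+1) (M n r * M n r) <= pint (t n) (t n.+1) (r * r) &
      pint (t n) (t n.+1) (M n r * M n r) <= pint (t n) (t n.+1) (r * M n r)].

Definition deriv_term (M : nat -> {poly R} -> {poly R}) : R :=
  \sum_(n < N) ip n (fun x => (U n x)^`()) (M n \o U n).

Definition grad_term (M : nat -> {poly R} -> {poly R}) : R :=
  \sum_i \sum_(n < N) ip n (M n \o G n i) (M n \o G n i).

Lemma energy_le (M : nat -> {linear {poly R} -> {poly R}}) (Jm : R) : admissible M ->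
  (forall n, (n < N)%N -> slab_mean n <= Jm) -> 0 <= Jm ->
  deriv_term M + nu * grad_term M / 2 <= Num.sqrt (K * Jm) * F + nu * Ynorm / 2.
Proof.
move=> aM JmP Jm0.
have sM n (r : {poly R}) : (n < N)%N -> (size (M n r) <= q.+2)%N.
  by move=> nN; have [sr _ _] := aM n r nN; exact: leqW.
have KJ0 : 0 <= K * Jm by rewrite mulr_ge0// ltW.
have := @tested_scheme_le M (Num.sqrt (K * Jm)) (sqrtr_ge0 _).
move=> /(_ _ _)/wrap[|n s nN sn|].
- by move=> n r nN _; have [] := aM n r nN.
- rewrite sqr_sqrtr//; apply: (@le_trans _ _ (K * slab_mean n)).
    apply: slab_value_le => //.
    + by case/andP: sn => /ltW -> /ltW ->.
    + by move=> r _; exact: sM.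
    + by move=> r; have [] := aM n r nN.
  by rewrite ler_pM2l// JmP.
rewrite -/(deriv_term M) -/(grad_term M); set A := \sum_i _; set B := grad_term M.
have BA : B <= A.
  apply: ler_sum => i _; apply: ler_sum => n _; have nN := ltn_ord n.
  have MG2 : L2poly (leb d) q.+2 (M n \o G n i).
    by apply: L2poly_linear (G2 i nN) _ => r _; exact: sM.
  by apply: (ip_le (n := n) MG2 MG2 (G2 i nN) MG2) => x; have [] := aM n (G n i x) nN.
have : nu * B <= nu * A by rewrite ler_pM2l.
rewrite mulrA mulrDr; lra.
Qed.

Hypothesis uUc : forall n x s, (n < N)%N -> O x -> t n <= s <= t n.+1 -> u (x, s) = (U n x).[s].

(** Taken from [u] and not from a slab polynomial, so that two slabs meeting at a node share one
    value there and the sums telescope. *)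
Definition energy s : R := \int[leb d]_x (((fun x => u (x, s)) \_ O) x ^+ 2).

Lemma energy_ge0 s : 0 <= energy s.
Proof. by apply: Rintegral_ge0 => x _; exact: sqr_ge0. Qed.

Lemma restrict_slab n s : (n < N)%N -> t n <= s <= t n.+1 ->
  (fun x => u (x, s)) \_ O = fun x => (U n x).[s].
Proof.
move=> nN sn; apply/funext => x; rewrite patchE; case: ifPn => [/set_mem Ox|/negP xO].
  by rewrite (uUc nN).
by have [U0 _] := disc_reps_out UG; rewrite U0 ?horner0// => /mem_set.
Qed.

Lemma energyE n s : (n < N)%N -> t n <= s <= t n.+1 ->
  energy s = \int[leb d]_x ((U n x).[s] ^+ 2).
Proof. by move=> nN sn; rewrite /energy (restrict_slab nN sn). Qed.

Lemma ip_deriv_Pi n : (n < N)%N ->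
  ip n (fun x => (U n x)^`()) (Pi n \o U n) = (energy (t n.+1) - energy (t n)) / 2.
Proof.
move=> nN; have tn := ltW (tlt nN).
rewrite !(energyE nN) ?lexx ?tn//.
have i1 := Lfun2_integrable_sqr (L2poly_horner (t n.+1) (U2 nN)).
have i0 := Lfun2_integrable_sqr (L2poly_horner (t n) (U2 nN)).
rewrite -RintegralB// -RintegralZr//; last exact: (integrableB measurableT i1 i0).
apply: eq_Rintegral => x _; apply: pint_deriv_pproj; first exact: tlt.
by have [+ _] := U2 nN; apply.
Qed.

(** The weighted inequality for polynomials, integrated in space. The energy at the start of the
    slab enters with a minus sign, to be cancelled by the earlier slabs. *)
Lemma ip_deriv_PB n : (n < N)%N ->
  (slab_mean n - energy (t n)) / 2 <= ip n (fun x => (U n x)^`()) (PB n \o U n).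
Proof.
move=> nN; have tn := ltW (tlt nN).
rewrite !(energyE nN) ?lexx ?tn// /slab_mean.
have iUU := ip_integrable n (U2 nN) (U2 nN).
have i0 := Lfun2_integrable_sqr (L2poly_horner (t n) (U2 nN)).
have iUUZ := integrableZr measurableT (t n.+1 - t n)^-1 iUU.
have iB := integrableB measurableT iUUZ i0.
rewrite -RintegralZr// -RintegralB// -RintegralZr//.
apply: le_Rintegral => //.
- exact: (integrableZr measurableT _ iB).
- apply: (ip_integrable n (dU2 nN) (m' := q.+2)).
  apply: L2poly_linear (U2 nN) _ => r _; exact: leqW (size_pproj _ _ _ _).
move=> x _; have [sU _] := U2 nN.
by have := pint_deriv_wproj_ge (tlt nN) (sU x); rewrite mulrBl.
Qed.

Lemma Pi_admissible : admissible (fun n => Pi n).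
Proof.
move=> n r nN; split; [exact: size_pproj|exact: (pint_sqr_pproj (tlt nN))|].
by rewrite (pint_mul_pproj (tlt nN)).
Qed.

(* Tests the scheme with [Pi u] before the slab [k] and with the weighted projection on it. *)
Definition stepM k n : {linear {poly R} -> {poly R}} :=
  if (n < k)%N then (Pi n : {linear {poly R} -> {poly R}})
  else if n == k then (PB n : {linear {poly R} -> {poly R}})
  else (\0%R : {linear {poly R} -> {poly R}}).

Lemma stepM_admissible k : admissible (stepM k).
Proof.
move=> n r nN; rewrite /stepM; case: ltnP => _; first exact: Pi_admissible.
case: eqP => _.
  split; first exact: size_pproj; last exact: (pint_sqr_wproj_le (tlt nN)).
  exact: (pint_sqr_wproj_le_sqr (tlt nN)).
by split; rewrite /= ?size_poly0// !mulr0 pint0// pint_sqr_ge0.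
Qed.

Section stability.
Variable Jm : R.
Hypotheses (Jm0 : 0 <= Jm) (JmP : forall n, (n < N)%N -> slab_mean n <= Jm).

Let bound := energy (t 0) + 2 * (Num.sqrt (K * Jm) * F) + nu * Ynorm.

Lemma gradient_le :
  nu * grad_term (fun n => Pi n) <= bound.
Proof.
have := energy_le Pi_admissible JmP Jm0.
have -> : deriv_term (fun n => Pi n) = energy (t N) / 2 - energy (t 0) / 2.
  rewrite -(telescope_sumr (fun n => energy (t n) / 2))// big_mkord.
  by apply: eq_bigr => n _; rewrite ip_deriv_Pi// mulrBl.
rewrite /bound; have := energy_ge0 (t N); lra.
Qed.

Lemma slab_mean_le k : (k < N)%N -> slab_mean k <= bound.
Proof.
move=> kN; have := energy_le (stepM_admissible k) JmP Jm0.
have D0 : 0 <= nu * grad_term (stepM k).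
  rewrite mulr_ge0 ?(ltW nu0)//; apply: sumr_ge0 => i _; apply: sumr_ge0 => n _.
  by apply: Rintegral_ge0 => x _; exact: pint_sqr_ge0.
suff : (slab_mean k - energy (t 0)) / 2 <= deriv_term (stepM k) by rewrite /bound; lra.
(* A lower bound for the contribution of slab [n]: nodal energies telescope up to [t k], cancel the
   loss in [ip_deriv_PB], and later slabs add nothing. *)
pose c n := if (n < k)%N then energy (t n.+1) / 2 - energy (t n) / 2
  else if n == k then (slab_mean k - energy (t k)) / 2 else 0.
have -> : (slab_mean k - energy (t 0)) / 2 = \sum_(n < N) c n.
  rewrite -(big_mkord xpredT c) (big_cat_nat (n := k)) ?(ltnW kN)//=.
  rewrite (eq_big_nat _ _ (F2 := fun n => energy (t n.+1) / 2 - energy (t n) / 2)); last first.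
    by move=> n /andP[_ nk]; rewrite /c nk.
  rewrite (telescope_sumr (fun n => energy (t n) / 2))// big_ltn// /c ltnn eqxx.
  rewrite big_nat big1; first by lra.
  by move=> n /andP[kn _]; rewrite ltnNge (ltnW kn)/= gtn_eqF.
apply: ler_sum => n _; rewrite /c /stepM; case: ltnP => _.
  by rewrite ip_deriv_Pi// mulrBl.
case: eqP => [<-|_]; first exact: ip_deriv_PB.
by apply: Rintegral_ge0 => x _ /=; rewrite mulr0 pint0.
Qed.

End stability.

Lemma energy_stability : let Z := 2 * energy 0 + 4 * K * F ^+ 2 + 2 * nu * Ynorm in
  (forall n s, (n < N)%N -> t n <= s <= t n.+1 -> energy s <= K * Z) /\
  nu * grad_term (fun n => Pi n) <= Z.
Proof.
move=> Z; have [t0 _ _] := tp.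
(* The base value 0 of the maximum provides [Jm0]. *)
pose Jm := \big[Num.max/0]_(n < N) slab_mean n.
have Jm0 : 0 <= Jm by exact: bigmax_ge_id.
have JmP n : (n < N)%N -> slab_mean n <= Jm.
  by move=> nN; exact: (le_bigmax 0 (fun i : 'I_N => slab_mean i) (Ordinal nN)).
set b := energy (t 0) + 2 * (Num.sqrt (K * Jm) * F) + nu * Ynorm.
have F0 : 0 <= F.
  by rewrite -lee_fin -FE; apply: integral_ge0 => s _; exact: Lnorm_ge0.
have Y0 : 0 <= nu * Ynorm.
  rewrite mulr_ge0 ?(ltW nu0)//; apply: sumr_ge0 => i _.
  by apply: Rintegral_ge0 => z _; exact: sqr_ge0.
have b0 : 0 <= b.
  rewrite !addr_ge0// ?energy_ge0//; first by rewrite mulr_ge0// mulr_ge0// sqrtr_ge0.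
have Jmb : Jm <= b.
  by apply: bigmax_le => // n _; exact: slab_mean_le.
have KJ0 : 0 <= K * Jm by rewrite mulr_ge0// ltW.
(* This is [(r - 2 K F)^2 >= 0] divided by [K]. So [2 r F] costs [Jm / 2], at most [b / 2];
   absorbing it doubles the remaining terms of [b], which gives [Z]. *)
have young : 4 * (Num.sqrt (K * Jm) * F) <= Jm + 4 * K * F ^+ 2.
  rewrite -(ler_pM2l K0); have := sqr_sqrtr KJ0; set r := Num.sqrt _ => rE.
  have := sqr_ge0 (r - 2 * K * F); rewrite mulrDr -rE; nra.
have bZ : b <= Z by rewrite /b /Z t0 in Jmb *; lra.
split=> [n s nN sn|]; last exact: le_trans (gradient_le Jm0 JmP) bZ.
rewrite (energyE nN sn).
apply: le_trans (_ : K * slab_mean n <= _).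
  by apply: (slab_value_le (M := idfun) nN sn).
by rewrite ler_pM2l// (le_trans (JmP n nN))// (le_trans Jmb).
Qed.

Lemma norm_C0L2_sqr_le (b : R) : 0 < T -> 0 <= b ->
  (forall n s, (n < N)%N -> t n <= s <= t n.+1 -> energy s <= b) ->
  (norm_C0L2 O T u ^+ 2 <= b%:E)%E.
Proof.
move=> T0 b0 eb; have [t0 tN _] := tp.
have N0 : (0 < N)%N by rewrite lt0n; apply/eqP => N0; move: T0; rewrite -tN N0 t0 ltxx.
have h1 : (norm_C0L2 O T u <= (Num.sqrt b)%:E)%E.
  apply: ge_ereal_sup => y [s /=]; rewrite in_itv/= => sT <-.
  have [n nN sn] : exists2 n, (n < N)%N & t n <= s <= t n.+1.
    by apply: closed_slab_index => //; rewrite t0 tN.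
  rewrite /L2norm (restrict_slab nN sn) (Lfun2_Lnorm (L2poly_horner s (U2 nN))) lee_fin.
  by rewrite ler_wsqrtr// -(energyE nN sn) (eb n).
have h0 : (0 <= norm_C0L2 O T u)%E.
  apply: (@le_trans _ _ (L2norm (leb d) O (fun x => u (x, 0)))); first exact: Lnorm_ge0.
  by apply: ereal_sup_ubound; exists 0 => //=; rewrite in_itv/= lexx ltW.
move: h0 h1; case: (norm_C0L2 O T u) => [r| |]//; rewrite -EFin_expe !lee_fin => r0 rb.
by rewrite -(sqr_sqrtr b0) ler_pXn2r// ?nnegrE// sqrtr_ge0.
Qed.

Lemma xgrad_norm_time_proj :
  (xgrad_norm O T (time_proj N t q u) ^+ 2 = (grad_term (fun n => Pi n))%:E)%E.
Proof.
have PG : disc_reps O Th p N q.+1 (fun n => Pi n \o U n) (fun n i => Pi n \o G n i).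
  by move=> n nN; apply: disc_rep_linear (UG nN) => r _; exact: size_pproj.
have [_ H0] := disc_reps_out PG.
rewrite (xgrad_norm_sqrE oO (is_xgrad_agrees tp PG (time_proj_agrees tp q uU))).
congr EFin; apply: eq_bigr => i _; rewrite (row_slabs (H0 i)).
have H2 n nN := (disc_rep_L2poly (PG n nN)).2 i.
by rewrite -(Rintegral_slabs_mul tlt H2 H2); apply: eq_Rintegral => z _; rewrite expr2.
Qed.

End energy.

(** At an end of the slab both sides have the same limit from inside. Continuity in time thus ties
    neighbouring slab polynomials together at the nodes. *)
Lemma closed_agrees (R : realType) d (O : set 'rV[R]_d) (T : R) N (t : nat -> R)
    (u : 'rV[R]_d * measurableTypeR R -> R) U : time_partition T N t -> agrees O N t u U ->
  (forall x, O x -> {within `[0, T], continuous (fun s => u (x, s))}) ->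
  forall n x s, (n < N)%N -> O x -> t n <= s <= t n.+1 -> u (x, s) = (U n x).[s].
Proof.
move=> tp uU cu n x s nN Ox; have [t0 tN tlt] := tp; have tn := tlt _ nN.
have : {within `[t n, t n.+1], continuous (fun s => u (x, s))}.
  apply: continuous_subspaceW (cu x Ox) => y /=; rewrite !in_itv/= => /andP[y1 y2].
  rewrite -t0 -tN; apply/andP; split.
    by apply: le_trans y1; apply: (partition_le tlt); rewrite leq0n ltnW.
  by apply: (le_trans y2); apply: (partition_le tlt); rewrite nN leqnn.
move=> /(continuous_within_itvP _ tn)[_ cl cr].
rewrite le_eqVlt => /andP[/predU1P[<- _|ns]].
  have h : u (x, y) @[y --> (t n)^'+] --> (U n x).[t n].
    have : (U n x).[y] @[y --> (t n)^'+] --> (U n x).[t n].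
      by apply: cvg_at_right_filter; exact: continuous_horner.
    apply: cvg_trans; apply: near_eq_cvg; near=> y; rewrite (uU n)//.
    by apply/andP; split; near: y; [exact: nbhs_right_gt|exact: nbhs_right_lt].
  exact: (cvg_unique _ cl h).
rewrite le_eqVlt => /predU1P[->|sn]; last by rewrite (uU n)// ns.
have h : u (x, y) @[y --> (t n.+1)^'-] --> (U n x).[t n.+1].
  have : (U n x).[y] @[y --> (t n.+1)^'-] --> (U n x).[t n.+1].
    by apply: cvg_at_left_filter; exact: continuous_horner.
  apply: cvg_trans; apply: near_eq_cvg; near=> y; rewrite (uU n)//.
  by apply/andP; split; near: y; [exact: nbhs_left_gt|exact: nbhs_left_lt].
exact: (cvg_unique _ cr h).
Unshelve. all: by end_near. Qed.

(** Testing the projection with [w] itself gives [|w|^2 = (f, w)], and Young's inequality absorbs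
    half of it. *)
Lemma L2proj_norm_le (disp : measure_display) (X : measurableType disp) (R : realType)
    (mu : {measure set X -> \bar R}) (D : set X) (V : set (X -> R)) (f w : X -> R) :
  L2 mu D f -> L2 mu D w -> is_L2proj mu D V f w ->
  \int[mu]_x ((w \_ D) x ^+ 2) <= \int[mu]_x ((f \_ D) x ^+ 2).
Proof.
move=> f2 w2 [Vw /(_ _ Vw)]; rewrite !L2ipE.
under eq_Rintegral do rewrite -expr2.
by have := Rintegral_mul_le f2 w2; lra.
Qed.

Theorem proposition5p2 (R : realType) (q : nat) (hq : (1 <= q)%N) :
  exists2 C : R, 0 < C &
  forall (d : nat) (Omega : set 'rV[R]_d) (T : R)
    (Th : seq 'M[R]_(d.+1, d)) (gamma : R) (p : nat)
    (N : nat) (t : nat -> R) (nu : R)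
    (f : 'rV[R]_d * R -> R) (u0 : 'rV[R]_d -> R)
    (Upsilon u : 'rV[R]_d * R -> R),
  (1 <= d <= 3)%N ->
  polytopic_domain Omega ->
  0 < T ->
  conforming_mesh Omega Th ->
  shape_regular gamma Th ->
  (1 <= p)%N ->
  time_partition T N t ->
  0 < nu ->
  L2 (leb_xt d) (QT Omega T) f ->
  L2 (leb d) Omega u0 ->
  L2H1 Omega T Upsilon ->
  Vcont Omega T N t (Vh Omega Th p) q u ->
  is_L2proj (leb d) Omega (Vh Omega Th p) u0 (fun x => u (x, 0)) ->
  (forall v, Vdisc Omega T N t (Vh Omega Th p) q.-1 v ->
     L2ip (leb_xt d) (QT Omega T) (dt u) v + nu * xgrad_ip Omega T u v =
     L2ip (leb_xt d) (QT Omega T) f v + nu * xgrad_ip Omega T Upsilon v) ->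
  (norm_C0L2 Omega T u ^+ 2 +
     nu%:E * xgrad_norm Omega T (time_proj N t q.-1 u) ^+ 2 <=
   C%:E * (L2norm (leb d) Omega u0 ^+ 2 + norm_L1L2 Omega T f ^+ 2 +
     nu%:E * xgrad_norm Omega T Upsilon ^+ 2))%E.
Proof.
(* From here the degree of the statement is [q.+1], and polynomials of that degree have size at most
   [q.+2]. *)
case: q hq => // q _.
have [K K0 KP] := inverse_estimate (R := R) q.+2.
(* [energy_stability] bounds the energy by [K * Z] and the gradient by [Z], whence [K + 1]; and [Z]
   is at most [4 * K + 2] times the data. *)
exists ((K + 1) * (4 * K + 2)); first by rewrite mulr_gt0 ?addr_gt0// mulr_gt0.
move=> d O T Th gamma p N t nu f u0 Ups u _ [_ _ [Ps OE]] T0 _ _ _ tp nu0 f2 u02 [_ [Y UpsY]]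
  [uV cu] projP scheme.
have oO : open O by rewrite OE; exact: open_interior.
have [U [G [UG uU]]] := Vdisc_rep uV.
have uUc := closed_agrees tp uU cu.
have w2 : L2 (leb d) O (fun x => u (x, 0)) by have [[[g [] //]]] := projP.
have e0 := L2proj_norm_le u02 w2 projP.
have YE : (xgrad_norm O T Ups ^+ 2 = (Ynorm O T Y)%:E)%E by exact: (xgrad_norm_sqrE oO UpsY).
have u0E : (L2norm (leb d) O u0 ^+ 2 = (\int[leb d]_x ((u0 \_ O) x ^+ 2))%:E)%E.
  rewrite L2norm_sqr /Rintegral fineK//; apply: integrable_fin_num => //.
  exact: Lfun2_integrable_sqr u02.
set I0 := (\int[leb d]_x ((u0 \_ O) x ^+ 2)) in e0 u0E.
have I00 : 0 <= I0 by apply: Rintegral_ge0 => x _; exact: sqr_ge0.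
have C0 : 0 < (K + 1) * (4 * K + 2) by rewrite mulr_gt0 ?addr_gt0// mulr_gt0.
have Y0 : 0 <= Ynorm O T Y.
  by apply: sumr_ge0 => i _; apply: Rintegral_ge0 => z _; exact: sqr_ge0.
rewrite u0E [X in (_ <= _ * (_ + _ * X))%E]YE.
have : (0 <= norm_L1L2 O T f)%E by apply: integral_ge0 => s _; exact: Lnorm_ge0.
(* An infinite norm of [f] makes the right-hand side infinite. *)
case FE : (norm_L1L2 O T f) => [F| |]// F0; last first.
  rewrite [X in (_ <= _ * (_ + X + _))%E]mulyy addey// addye// gt0_muley ?leey// lte_fin//.
rewrite (xgrad_norm_time_proj oO tp UG uU).
have [eZ gZ] := energy_stability oO tp nu0 f2 FE UpsY UG uU scheme K0 KP uUc.
set Z := (2 * energy O u 0 + _ + _) in eZ gZ.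
have nY0 : 0 <= nu * Ynorm O T Y by rewrite mulr_ge0// ltW.
have ZI : Z <= (4 * K + 2) * (I0 + F ^+ 2 + nu * Ynorm O T Y).
  have := mulr_ge0 (ltW K0) I00; have := mulr_ge0 (ltW K0) nY0; have := sqr_ge0 F.
  move: e0; rewrite /Z -/(energy O u 0); nra.
have Z0 : 0 <= Z.
  by rewrite !addr_ge0// ?mulr_ge0 ?energy_ge0 ?sqr_ge0// ltW.
have KZ0 : 0 <= K * Z by rewrite mulr_ge0// ltW.
apply: (@le_trans _ _ ((K * Z)%:E + Z%:E)%E).
  apply: leeD; last by rewrite -EFinM lee_fin.
  exact: (norm_C0L2_sqr_le tp UG uUc T0 KZ0 eZ).
rewrite -EFin_expe -!(EFinD, EFinM) lee_fin.
by rewrite -mulrA -[X in _ + X]mul1r -mulrDl ler_pM2l// addr_gt0.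
Qed.
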